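(* Let $D$ be a non-commutative division ring with center $F$, let $M$ be a non-abelian locally solvable maximal subgroup of $D^*$, and let $A$ be a maximal abelian normal subgroup of $M$. If there exists an element $\alpha\in A\setminus F$ that is algebraic over $F$, then $[D:F]<\infty$.
   Context: $D^*$ is the multiplicative group of $D$; maximal subgroup = proper subgroup maximal among proper subgroups. Locally solvable: every finitely generated subgroup solvable. A maximal abelian normal subgroup is an abelian normal subgroup not properly contained in another abelian normal subgroup. *)

(* Defs.v *)
From HB Require Import structures.
From mathcomp Require Import all_boot all_order all_algebra.
Set Implicit Arguments. Unset Strict Implicit. Unset Printing Implicit Defensive.
Import GRing.Theory.
Local Open Scope ring_scope.

Section Defs.
Variable R : unitRingType.

Definition is_division_ring : Prop := forall x : R, x != 0 -> x \is a GRing.unit.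

Definition is_subgroup (H : R -> Prop) : Prop :=
  [/\ (forall x, H x -> x \is a GRing.unit), H 1,
      (forall x y, H x -> H y -> H (x * y)) & (forall x, H x -> H x^-1)].

Definition gen (S : R -> Prop) : R -> Prop :=
  fun x => forall H, is_subgroup H -> (forall y, S y -> H y) -> H x.

Definition gcomm (x y : R) : R := x^-1 * y^-1 * x * y.

Definition derived (H : R -> Prop) : R -> Prop :=
  gen (fun z => exists x y, [/\ H x, H y & z = gcomm x y]).

Definition solvable_grp (H : R -> Prop) : Prop :=
  exists n : nat, forall x, iter n derived H x -> x = 1.

Definition locally_solvable (M : R -> Prop) : Prop :=
  forall s : seq R, (forall x, x \in s -> M x) -> solvable_grp (gen (fun x => x \in s)).

Definition abelian_set (A : R -> Prop) : Prop :=
  forall x y, A x -> A y -> x * y = y * x.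

Definition maximal_subgroup_units (M : R -> Prop) : Prop :=
  [/\ is_subgroup M, (exists x, x \is a GRing.unit /\ ~ M x) &
      forall H, is_subgroup H -> (forall x, M x -> H x) ->
        (forall x, H x -> M x) \/ (forall x, x \is a GRing.unit -> H x)].

Definition normal_in (A M : R -> Prop) : Prop :=
  [/\ is_subgroup A, (forall x, A x -> M x) &
      forall m a, M m -> A a -> A (m^-1 * a * m)].

Definition max_abelian_normal (A M : R -> Prop) : Prop :=
  [/\ normal_in A M, abelian_set A &
      forall B, normal_in B M -> abelian_set B -> (forall x, A x -> B x) ->
        forall x, B x -> A x].

Definition center (x : R) : Prop := forall y : R, x * y = y * x.

Definition algebraic_over_center (a : R) : Prop :=
  exists p : {poly R}, [/\ p != 0, (forall i, center p`_i) & root p a].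

Definition finite_dim_over_center : Prop :=
  exists s : seq R, forall d : R, exists c : nat -> R,
    (forall i, center (c i)) /\ d = \sum_(i < size s) c i * s`_i.
End Defs.

(* Main.v *)
(** Let [O] be the set of [M]-conjugates of [alpha]. It lies in the abelian
    group [A] and consists of roots of one polynomial over the center, so it is
    finite. Let [E] be the centraliser of [O] in [D], a division subring
    normalised by [M]. By maximality the normaliser of [E] is [M] or [D^*]; the
    Cartan-Brauer-Hua theorem excludes the latter, so [E^*] is contained in [M]
    and is locally solvable, which forces [E] to be commutative. Two
    applications of Dedekind-Artin independence then bound the dimension of [D]
    over [E] by that of the algebra generated by [O], and the dimension of [D]
    over its center by the square of the former.

    That a division ring with locally solvable multiplicative group is
    commutative is a local form of Hua's theorem. If [x] and [y] do not commute,
    let [G] be generated by [x], [1 + x], [y], [1 + y]. Hua's trick makes every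
    abelian normal subgroup of [G] central. If [H] is normal in [G] with [H, H]
    central, and [h] in [H] does not commute with [x], then with
    [b = [1 + x, h]], [a = [x, h]] and [c = b a^-1] one has
    [(1 - c) x = b - 1]. Conjugating this relation by elements of [H] and
    separating characters modulo the center of [H] leaves only four quadratic
    equations for [x] (which occur in octahedral quaternion groups), and these
    can be avoided by changing [x] and [y]. So the derived series of [G]
    is central from its end up to [G] itself, a contradiction. *)
From HB Require Import structures.
From mathcomp Require Import all_boot all_order all_algebra.
From mathcomp Require Import boolp ring.
Require Import Defs.
Set Implicit Arguments. Unset Strict Implicit. Unset Printing Implicit Defensive.
Import GRing.Theory.
Local Open Scope ring_scope.

(** * Subfields of a division ring as bicommutants of commuting sets *)

Section Bic.
Variable D : unitRingType.
Definition comm_all (S : D -> Prop) (z : D) := forall u, S u -> z * u = u * z.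
Definition bicommutant (S : D -> Prop) : pred D :=
  fun x => `[< comm_all (comm_all S) x >].

Lemma bicommutant_divring S : divring_closed (bicommutant S).
Proof.
split.
- by apply/asboolP => z _; rewrite mul1r mulr1.
- move=> x y /asboolP hx /asboolP hy; apply/asboolP => z hz.
  by rewrite mulrBl mulrBr hx ?hy.
- move=> x y /asboolP hx /asboolP hy; apply/asboolP => z hz.
  have cy : GRing.comm z y^-1 by apply: commrV; apply/esym/hy.
  by rewrite -mulrA -cy mulrA hx // mulrA.
Qed.
HB.instance Definition _ S := GRing.isDivringClosed.Build D (bicommutant S) (bicommutant_divring S).

Hypothesis hD : is_division_ring D.
Variable S : D -> Prop.
Hypothesis hS : abelian_set S.

(** The two proofs are parameters so that the commutative and field structures below, which depend
    on them, can be attached to the type. *)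
Definition bicommutant_field (_ : is_division_ring D) (_ : abelian_set S) := {x : D | x \in bicommutant S}.
Local Notation T := (bicommutant_field hD hS).
HB.instance Definition _ := Choice.on T.
HB.instance Definition _ := SubChoice.on T.
HB.instance Definition _ := [SubChoice_isSubUnitRing of T by <:].
Lemma bicommutant_mulC : commutative (@GRing.mul T).
Proof.
move=> x y; apply: val_inj; rewrite !rmorphM /=.
case: x y => [x /= /asboolP hx] [y /= /asboolP hy].
by apply: hx => u Su; apply: hy => v Sv; apply: hS.
Qed.
HB.instance Definition _ := GRing.PzRing_hasCommutativeMul.Build T bicommutant_mulC.
Lemma bicommutant_fieldP : GRing.field_axiom T.
Proof.
move=> x nx; change (val x \is a GRing.unit); apply: hD.
by apply: contra nx => /eqP x0; apply/eqP/val_inj; rewrite x0 rmorph0.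
Qed.
HB.instance Definition _ := GRing.ComUnitRing_isField.Build T bicommutant_fieldP.
End Bic.

(** A commuting set lies in its bicommutant, which is then commutative. Computations among such
    elements move to a [fieldType], where [ring] and [field] apply. *)
Lemma abelian_set_in_field (D : unitRingType) (S : D -> Prop) :
  is_division_ring D -> abelian_set S ->
  exists (K : fieldType) (f : {rmorphism K -> D}),
    forall z, S z -> exists k, f k = z.
Proof.
move=> hD hS; exists (bicommutant_field hD hS : fieldType), val => z Sz.
have bz : z \in bicommutant S by apply/asboolP => u /(_ z Sz).
by exists (exist _ z bz).
Qed.

(* In Hamilton's quaternions, suitable roots [x] of these quadratics normalise
   Q8 together with [1 + x] without centralising it: up to real factors they lie
   in the binary octahedral group. *)
Definition exceptional (D : unitRingType) (x : D) : Prop :=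
  (2 : D) != 0 /\
  [\/ x ^+ 2 + x + 1 = 0, x ^+ 2 + 1 = 0, (1 + x) ^+ 2 + 1 = 0
    | 2 * x ^+ 2 + 2 * x + 1 = 0].

Lemma division_mul_eq0 (D : unitRingType) (x y : D) :
  is_division_ring D -> x * y = 0 -> x = 0 \/ y = 0.
Proof.
move=> hD e; have [->|/hD ux] := eqVneq x 0; first by left.
by right; rewrite -(mulKr ux y) e mulr0.
Qed.

(** * Commutators in a normal subgroup [H] of [G] with [[H, H]] central, meaning commuting with
    [G] *)

Section Commutators.
Variable D : unitRingType.
Hypothesis hD : is_division_ring D.
Variables G H : D -> Prop.
Hypotheses (hG : is_subgroup G) (hH : is_subgroup H).
Hypothesis HG : forall x, H x -> G x.
Hypothesis hN : forall g h, G g -> H h -> H (g * h * g^-1).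
Hypothesis HHK : forall u v, H u -> H v -> comm_all G (u * v * u^-1 * v^-1).
Hypothesis ZHK : forall u, H u -> comm_all H u -> comm_all G u.

Let Gu x : G x -> x \is a GRing.unit. Proof. by case: hG => + _ _ _; apply. Qed.
Let GM x y : G x -> G y -> G (x * y). Proof. by case: hG => _ _ + _; apply. Qed.
Let GV x : G x -> G x^-1. Proof. by case: hG => _ _ _; apply. Qed.
Let Hu x : H x -> x \is a GRing.unit. Proof. by move/HG/Gu. Qed.
Let HM x y : H x -> H y -> H (x * y). Proof. by case: hH => _ _ + _; apply. Qed.
Let HV x : H x -> H x^-1. Proof. by case: hH => _ _ _; apply. Qed.
Let H1 : H 1. Proof. by case: hH. Qed.

Lemma comm_allB x y : comm_all G x -> comm_all G y -> comm_all G (x - y).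
Proof. by move=> hx hy u Gu'; rewrite mulrBl mulrBr hx ?hy. Qed.
Lemma comm_allM x y : comm_all G x -> comm_all G y -> comm_all G (x * y).
Proof. by move=> hx hy u Gu'; rewrite -mulrA hy // mulrA hx // mulrA. Qed.
Lemma comm_allV x : comm_all G x -> comm_all G x^-1.
Proof. by move=> hx u Gu'; apply/esym/commrV/esym/hx. Qed.
Lemma comm_allN x : comm_all G x -> comm_all G (- x).
Proof. by move=> hx u Gu'; rewrite mulNr mulrN hx. Qed.
Lemma comm_all1 : comm_all G 1.
Proof. by move=> u _; rewrite mulr1 mul1r. Qed.
Lemma comm_allD x y : comm_all G x -> comm_all G y -> comm_all G (x + y).
Proof. by move=> hx hy u Gu'; rewrite mulrDl mulrDr hx ?hy. Qed.

(* Dedekind independence of characters: conjugation by [t] in [H] multiplies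
   each [u] in [H] by a scalar commuting with [G]. *)
Lemma isolate_class (s : seq (D * D)) z0 u0 :
  comm_all G z0 -> H u0 ->
  (forall p, p \in s ->
     [/\ comm_all G p.1, H p.2 & ~ comm_all G (p.2 * u0^-1)]) ->
  z0 * u0 + \sum_(p <- s) p.1 * p.2 = 0 -> z0 = 0.
Proof.
elim: {s}(size s) {-2}s (leqnn (size s)) z0 => [|n IH] [|[z u] s] //= sn z0 Kz0 Hu0 hs.
- rewrite big_nil addr0 => e; rewrite -[z0](mulrK (Hu Hu0)) e mul0r //.
- rewrite big_nil addr0 => e; rewrite -[z0](mulrK (Hu Hu0)) e mul0r //.
rewrite big_cons /= => e.
have [/= Kz Hu1 nsim] := hs (z, u) (mem_head _ _).
(* [u u0^-1] is not central, so by [ZHK] some [t] in [H] fails to commute with it; the characters of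
   [t] at [u] and [u0] then differ. *)
have [t Ht nt] : exists2 t, H t & (u * u0^-1) * t <> t * (u * u0^-1).
  apply: contra_notP nsim => h; apply: ZHK; first exact/HM/HV.
  by move=> t Ht; apply: contra_notP h => ?; exists t.
pose chi v := t * v * t^-1 * v^-1.
have Kchi v : H v -> comm_all G (chi v) by move=> Hv; apply: HHK.
have Gchi v : H v -> G (chi v).
  by move=> Hv; apply: HG; do 2?apply: HM; do ?apply: HV => //; apply: HM.
have tE v : H v -> t * v = chi v * v * t.
  by move=> Hv; rewrite /chi mulrVK ?Hu // mulrVK ?Hu.
clearbody chi.
have nchi : chi u0 - chi u != 0.
  apply/eqP => /eqP; rewrite subr_eq0 => /eqP ec; apply: nt.
  apply: (mulIr (Hu Hu0)); rewrite -!mulrA mulVr ?Hu // mulr1.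
  rewrite [t * u0]tE // [t * u]tE // (Kchi _ Hu0 u0); last exact: HG.
  rewrite -[_ * chi u0 * t]mulrA mulKr ?Hu // ec !mulrA.
  by rewrite (Kchi _ Hu1 u) //; apply: HG.
pose s' := [seq (p.1 * (chi p.2 - chi u), p.2) | p <- s].
have es : z0 * chi u0 * u0 + z * chi u * u
          + \sum_(p <- s) p.1 * chi p.2 * p.2 = 0.
  apply: (mulIr (Hu Ht)); rewrite mul0r.
  have tz z1 v : comm_all G z1 -> H v -> z1 * chi v * v * t = t * (z1 * v).
    by move=> Kz1 Hv; rewrite [RHS]mulrA -(Kz1 t); last exact: HG; rewrite -!mulrA tE // -!mulrA.
  rewrite !mulrDl !tz // mulr_suml.
  rewrite (eq_big_seq (fun p => t * (p.1 * p.2))) => [|p ps]; last first.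
    by have [|? ? _] := hs p; rewrite ?in_cons ?ps ?orbT // tz.
  by rewrite -mulr_sumr -!mulrDr -addrA e mulr0.
(* Subtracting [chi u] times the original relation cancels the term of [u], so the induction applies
   to a shorter sum. *)
have e' : z0 * (chi u0 - chi u) * u0 + \sum_(p <- s') p.1 * p.2 = 0.
  have := congr1 (fun w => w - chi u * (z0 * u0 + (z * u + \sum_(p <- s) p.1 * p.2))) es.
  rewrite {2}e mulr0 subr0 => e2; apply: etrans e2; rewrite big_map /= !mulrDr mulr_sumr.
  have uz z1 v : comm_all G z1 -> chi u * (z1 * v) = z1 * chi u * v.
    by move=> Kz1; rewrite mulrA Kz1 //; apply: Gchi.
  rewrite !uz // [X in _ = _ - (_ + (_ + X))](eq_big_seq (fun p => p.1 * chi u * p.2)).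
    rewrite (eq_bigr (fun p => p.1 * chi p.2 * p.2 - p.1 * chi u * p.2)).
      rewrite sumrB mulrN mulrBl addrACA -opprD.
      by rewrite [X in _ = X - _]addrAC [X in _ = _ - X]addrCA addrKA.
    by move=> p _; rewrite mulrBr mulrBl.
  by move=> p ps; have [|? ? _] := hs p; rewrite ?in_cons ?ps ?orbT // uz.
have z00 : z0 * (chi u0 - chi u) = 0.
  have K0 v : H v -> comm_all G (chi v - chi u).
    by move=> Hv; apply: comm_allB; apply: Kchi.
  apply: (IH s') e' => //; rewrite ?size_map //; first exact/comm_allM/K0.
  move=> q /mapP[p ps ->] /=; have [|? ? ?] := hs p; first by rewrite in_cons ps orbT.
  by split=> //; apply/comm_allM/K0.
by rewrite -[z0](mulrK (hD nchi)) z00 mul0r.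
Qed.

(** * Triples with product one: separating the classes modulo central elements *)

Section Triple.
Variables (F : fieldType) (f : {rmorphism F -> D}) (y : D).
Hypothesis Hy : H y.

Local Notation K z := (comm_all G (f z)).

Let KB a b : K a -> K b -> K (a - b). Proof. by rewrite rmorphB; apply: comm_allB. Qed.
Let KD a b : K a -> K b -> K (a + b). Proof. by rewrite rmorphD; apply: comm_allD. Qed.
Let KM a b : K a -> K b -> K (a * b). Proof. by rewrite rmorphM; apply: comm_allM. Qed.
Let KN a : K a -> K (- a). Proof. by rewrite rmorphN; apply: comm_allN. Qed.
Let KV a : K a -> K a^-1. Proof. by rewrite fmorphV; apply: comm_allV. Qed.
Let K1 : K 1. Proof. by rewrite rmorph1; apply: comm_all1. Qed.
Let KN1 : K (-1). Proof. exact/KN/K1. Qed.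
Let KVE a : K a^-1 -> K a. Proof. by move/KV; rewrite invrK. Qed.

Let HfV a : H (f a) -> H (f a^-1). Proof. by rewrite fmorphV; apply: HV. Qed.

Let HnF0 a : H (f a) -> a != 0.
Proof. by move/Hu; apply: contraTneq => ->; rewrite rmorph0 unitr0. Qed.

Lemma isolate_class_field (s : seq (F * F)) z0 u0 :
  K z0 -> H (f u0) ->
  (forall p, p \in s -> [/\ K p.1, H (f p.2) & ~ K (p.2 / u0)]) ->
  z0 * u0 + \sum_(p <- s) p.1 * p.2 = 0 -> z0 = 0.
Proof.
move=> Kz Hu0 hs /(congr1 f); rewrite rmorph0 rmorphD rmorphM rmorph_sum.
rewrite (eq_bigr (fun p => f p.1 * f p.2)) => [e|p _]; last exact: rmorphM.
apply: (fmorph_inj f); rewrite rmorph0.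
apply: (@isolate_class [seq (f p.1, f p.2) | p <- s] _ (f u0)) => //; last first.
  by rewrite big_map.
move=> q /mapP[p ps ->] /=; have [? ? nK] := hs p ps.
by split=> //; move: nK; rewrite rmorphM fmorphV.
Qed.

(** [f x] is an eigenvector of conjugation by [y] with eigenvalue [f a]; for [f x] in [H] this
    eigenvalue is a commutator. *)
Definition conj_scales a x := y * f x = f (a * x) * y.

Lemma conj_scalesM a b x z :
  conj_scales a x -> conj_scales b z -> conj_scales (a * b) (x * z).
Proof.
rewrite /conj_scales => ex ez.
by rewrite rmorphM mulrA ex -mulrA ez mulrA -rmorphM mulrACA.
Qed.

Lemma conj_scalesV a x : x != 0 -> conj_scales a x -> conj_scales a^-1 x^-1.
Proof.
rewrite /conj_scales => x0 ex.
have fx0 : f x \is a GRing.unit by rewrite fmorph_unit.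
have a0 : a * x != 0.
  apply/eqP => a0; move: ex; rewrite a0 rmorph0 mul0r => /(canRL (mulrK fx0)).
  by rewrite mul0r => y0; move: (Hu Hy); rewrite y0 unitr0.
apply: (mulIr fx0); rewrite -mulrA -rmorphM mulVf // rmorph1 mulr1.
rewrite -mulrA ex mulrA -rmorphM -invfM mulVf ?rmorph1 ?mul1r //.
Qed.

Lemma conj_scales_central a x : x != 0 -> K x -> conj_scales a x -> a = 1.
Proof.
rewrite /conj_scales => x0 Kx; rewrite -Kx; last exact: HG.
move/(mulIr (Hu Hy))/fmorph_inj => e; apply: (mulIf x0).
by rewrite mul1r.
Qed.

(* The last equation is what remains of [(1 - c) x = b' - 1] after eliminating
   [x] with its conjugate by [y], for [A = c / b'], [B = b'], [C = c^-1]; it is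
   invariant under rotation of [A, B, C]. *)
Definition triple a b A B C :=
  [/\ [/\ H (f A), H (f B) & H (f C)], K a /\ K b,
      conj_scales a A /\ conj_scales b B, [/\ A != 1, B != 1 & C != 1] &
      A * B * C = 1 /\
      a * A - A^-1 + (B - b^-1 * B^-1) + (b^-1 * C - a * C^-1) = 0].

Lemma conj_scales_neq0 a x : H (f x) -> conj_scales a x -> a != 0.
Proof.
move=> Hx; rewrite /conj_scales; apply: contra_eqN => /eqP->.
rewrite mul0r rmorph0 mul0r; apply/eqP => e.
by move: (Hu (HM Hy Hx)); rewrite e unitr0.
Qed.

(** Since [C = (A B)^-1], its eigenvalue is [(a b)^-1], and the rotated relation is [b] times the
    old one. *)
Lemma triple_rot a b A B C : triple a b A B C -> triple b (a * b)^-1 B C A.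
Proof.
case=> [[HA HB HC] [Ka Kb] [ca cb] [nA nB nC] [e r]].
have [A0 B0] := (HnF0 HA, HnF0 HB).
have [a0 b0] := (conj_scales_neq0 HA ca, conj_scales_neq0 HB cb).
have eC : C = (A * B)^-1.
  by apply: (mulfI (mulf_neq0 A0 B0)); rewrite e divff ?mulf_neq0.
split.
- by split.
- by split=> //; apply: KV (KM Ka Kb).
- split=> //; rewrite eC.
  by apply: conj_scalesV; rewrite ?mulf_neq0 //; apply: conj_scalesM.
- by split.
 - split; first by rewrite -e; ring.
  rewrite -[RHS](mulr0 b) -r eC; field.
  by rewrite A0 B0 a0 b0 oner_neq0.
Qed.

(** A central [A] has eigenvalue 1. Were [B] central too, the relation would read
    [(A - 1) (B - 1) (C - 1) = 0]. So the class of 1 contributes only [A - A^-1], whence [A = -1],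
    and the rest becomes [B^2 = b^-1]. This is central, so [b^2 = 1], and [b = 1] would make [B]
    equal to 1 or -1. *)
Lemma triple_central a b A B C : triple a b A B C -> K A -> A = -1 /\ B ^+ 2 = -1.
Proof.
case=> [[HA HB HC] [Ka Kb] [ca cb] [nA nB nC] [e r]] KA.
have [A0 B0] := (HnF0 HA, HnF0 HB).
have [a0 b0] := (conj_scales_neq0 HA ca, conj_scales_neq0 HB cb).
have eC : C = (A * B)^-1.
  by apply: (mulfI (mulf_neq0 A0 B0)); rewrite e divff ?mulf_neq0.
have a1 : a = 1 by apply: conj_scales_central ca.
subst a.
have nKB : ~ K B.
  move=> KB'; have b1 : b = 1 by apply: conj_scales_central cb.
  subst b.
  have : (A - 1) * (B - 1) * (C - 1) = 0.
    by rewrite -[RHS]r eC; field; rewrite A0 B0.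
  by move/eqP; rewrite !mulf_eq0 !subr_eq0 (negPf nA) (negPf nB) (negPf nC).
have nKC : ~ K C.
  by rewrite eC => /KVE KAB; apply: nKB; rewrite -(mulKf A0 B); apply/KM/KAB/KV.
have AV : A - A^-1 = 0.
  apply: (@isolate_class_field [:: (1, B); (- b^-1, B^-1); (b^-1, C); (-1, C^-1)] _ 1).
  - exact/KB/KV.
  - by rewrite rmorph1.
  - move=> p; rewrite !inE => /or4P[] /eqP-> /=; rewrite divr1; split=> //.
    + exact: KN (KV Kb).
    + exact: HfV.
    + by move=> h; apply: nKB (KVE h).
    + exact: KV.
    + exact: HfV.
    + by move=> h; apply: nKC (KVE h).
  - by rewrite !big_cons big_nil /= -[RHS]r; ring.
have A1 : A = -1.
  have : A ^+ 2 == 1 by rewrite -subr_eq0 -(mul0r A) -AV; apply/eqP; field.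
  by rewrite sqrf_eq1 (negPf nA) => /eqP.
split=> //.
have two0 : (2 : F) != 0.
  by apply: contraNneq nA => e2; rewrite A1 -subr_eq0 -opprD oppr_eq0 -[1 + 1]/(2%:R) e2.
have B2 : B ^+ 2 = b^-1.
  apply: (mulfI two0); apply/eqP; rewrite -subr_eq0; apply/eqP.
  rewrite -[RHS](mulr0 B) -r eC A1; field.
  by rewrite B0 b0 /=; apply/negP; rewrite oppr_eq0 oner_eq0.
have b21 : b ^+ 2 = 1.
  apply: (@conj_scales_central _ (B ^+ 2)).
  - by rewrite expf_neq0.
  - by rewrite B2; apply: KV.
  - by rewrite !expr2; apply: conj_scalesM.
move/eqP: b21; rewrite sqrf_eq1 => /orP[]/eqP bE; last by rewrite B2 bE invrN1.
case: nKB; move/eqP: B2; rewrite bE invr1 sqrf_eq1 (negPf nB) => /eqP->.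
exact: KN1.
Qed.

(** The class of [A] contains only [A] and [A^-1], so [a = A^-2]. As [A^2] is central with
    eigenvalue [a^2], this gives [a^2 = 1]; and [a = 1] would make [A] equal to 1 or -1. Recording
    [a <> 1] beside [a = -1] rules out characteristic 2. *)
Lemma triple_involutive a b A B C :
  triple a b A B C -> ~ K A -> ~ K B -> ~ K C ->
  K (A ^+ 2) -> ~ K (B / A) -> ~ K (C / A) -> a = -1 /\ a <> 1.
Proof.
case=> [[HA HB HC] [Ka Kb] [ca cb] [nA nB nC] [e r]] nKA nKB nKC KA2 nBA nCA.
have [A0 B0] := (HnF0 HA, HnF0 HB).
have [a0 b0] := (conj_scales_neq0 HA ca, conj_scales_neq0 HB cb).
have eC : C = (A * B)^-1.
  by apply: (mulfI (mulf_neq0 A0 B0)); rewrite e divff ?mulf_neq0.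
have C0 := HnF0 HC.
have aA : a - A ^- 2 = 0.
  apply: (@isolate_class_field
    [:: (1, B); (- b^-1, B^-1); (b^-1, C); (- a, C^-1)] _ A) => //.
  - exact: KB (KV KA2).
  - move=> p; rewrite !inE => /or4P[] /eqP-> /=; split=> //.
    + exact: KN (KV Kb).
    + exact: HfV.
    + by rewrite -invfM mulrC -eC.
    + exact: KV.
    + exact: KN.
    + exact: HfV.
    + by rewrite eC invrK mulrAC divff ?mul1r.
  - by rewrite !big_cons big_nil /= -[RHS]r; field; rewrite C0 A0 B0 b0.
have {aA} aA : a = A ^- 2 by apply/eqP; rewrite -subr_eq0 aA.
have a2 : a ^+ 2 = 1.
  apply: (@conj_scales_central _ (A ^+ 2)) => //; first by rewrite expf_neq0.
  by rewrite !expr2; apply: conj_scalesM.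
have na1 : a <> 1.
  move=> a1; have : A ^+ 2 == 1 by rewrite -[A ^+ 2]invrK -aA a1 invr1.
  by rewrite sqrf_eq1 (negPf nA) => /eqP A1; apply: nKA; rewrite A1.
by split=> //; move/eqP: a2; rewrite sqrf_eq1 => /orP[]/eqP.
Qed.

(** With all three elements in one class, [A^3] is central and [a^3 = 1]. Separating [A] from [A^-1]
    gives two equations, which yield a central root [w] of [w^2 + w + 1] and [A^3 = 1]; then [A] is
    a power of [w]. *)
Lemma triple_cube a b A B C :
  triple a b A B C -> ~ K A -> ~ K B -> ~ K C ->
  K (B / A) -> K (C / A) -> False.
Proof.
case=> [[HA HB HC] [Ka Kb] [ca cb] [nA nB nC] [e r]] nKA nKB nKC.
have [A0 B0] := (HnF0 HA, HnF0 HB).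
have [a0 b0] := (conj_scales_neq0 HA ca, conj_scales_neq0 HB cb).
have C0 := HnF0 HC.
set p := B / A; set q := C / A => Kp Kq.
have BE : B = p * A by rewrite /p mulfVK.
have CE : C = q * A by rewrite /q mulfVK.
have p0 : p != 0 by rewrite /p mulf_neq0 ?invr_neq0.
have q0 : q != 0 by rewrite /q mulf_neq0 ?invr_neq0.
have eC : C = (A * B)^-1.
  by apply: (mulfI (mulf_neq0 A0 B0)); rewrite e divff ?mulf_neq0.
have cp : conj_scales (b / a) p by apply: conj_scalesM => //; apply: conj_scalesV.
have cq : conj_scales ((a * b)^-1 / a) q.
  apply: conj_scalesM; last exact: conj_scalesV.
  by rewrite eC; apply: conj_scalesV; rewrite ?mulf_neq0 //; apply: conj_scalesM.
clearbody p q.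
have A3 : A ^+ 3 = (p * q)^-1.
  have e3 : p * q * A ^+ 3 = 1 by rewrite -[RHS]e BE CE; ring.
  by apply: (mulfI (mulf_neq0 p0 q0)); rewrite e3 mulfV ?mulf_neq0.
have nKAA : ~ K (A^-1 / A).
  rewrite -invfM => /KVE KA2; apply: nKA.
  have -> : A = A ^+ 3 / (A * A) by field.
  by rewrite A3; apply: KM; apply: KV => //; apply: KM.
have ba : b / a = 1.
  exact: conj_scales_central cp.
have {}ba : b = a by rewrite -(mulfVK a0 b) ba mul1r.
subst b.
have a3 : a ^+ 3 = 1.
  rewrite -[a ^+ 3]invrK.
  have -> : (a ^+ 3)^-1 = (a * a)^-1 * a^-1 by field.
  by rewrite (conj_scales_central q0 Kq cq) invr1.
have e1 : a + p + a^-1 * q = 0.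
  apply: (@isolate_class_field [:: (- (1 + a^-1 * p^-1 + a * q^-1), A^-1)] _ A) => //.
  - by apply: KD (KM (KV Ka) Kq); apply: KD.
  - move=> u; rewrite inE => /eqP-> /=; split=> //; last exact: HfV.
    by apply: KN; apply: KD (KM Ka (KV Kq)); apply: KD K1 (KM (KV Ka) (KV Kp)).
  - by rewrite big_seq1 /= -[RHS]r BE CE; field; rewrite A0 a0 p0 q0.
have e2 : p * q + a ^+ 2 * q + a * p = 0.
  have : (a + p + a^-1 * q) * A - (1 + a^-1 * p^-1 + a * q^-1) / A = 0.
    by rewrite -[RHS]r BE CE; field; rewrite A0 a0 p0 q0.
  rewrite e1 mul0r sub0r => /eqP; rewrite oppr_eq0 mulf_eq0 invr_eq0 (negPf A0) orbF => /eqP e2.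
  rewrite -[RHS](mulr0 (p * q)) -e2; have -> : a ^+ 2 = a^-1.
    by rewrite -[RHS]mul1r -a3; field.
  by field; rewrite a0 p0 q0.
have qE : q = - (a * (a + p)).
  have -> : q = a * (a + p + a^-1 * q) - a * (a + p) by field.
  by rewrite e1 mulr0 sub0r.
(* The cube root of unity is [p] when [a = 1], and [a] itself otherwise. *)
have [w Kw [w3 A31]] : exists2 w, K w & w ^+ 2 + w + 1 = 0 /\ A ^+ 3 = 1.
  have := a3; move/eqP; rewrite -subr_eq0.
  have -> : a ^+ 3 - 1 = (a - 1) * (a ^+ 2 + a + 1) by ring.
  rewrite mulf_eq0 => /orP[]/eqP ea.
    move/eqP: ea; rewrite subr_eq0 => /eqP a1; subst a.
    have pp : p ^+ 2 + p + 1 = 0.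
      by rewrite -[RHS]oppr0 -e2 qE; ring.
    exists p => //; split=> //; rewrite A3 qE.
    have -> : p * - (1 * (1 + p)) = 1 - (p ^+ 2 + p + 1) by ring.
    by rewrite pp subr0 invr1.
  have pp : (p - 1) ^+ 2 = 0.
    apply: (mulfI a0); rewrite mulr0.
    have -> : a * (p - 1) ^+ 2 =
        - (p * - (a * (a + p)) + a ^+ 2 * - (a * (a + p)) + a * p)
        - (a ^+ 2 + a + 1) * (a * p + a * (a - 1)) by ring.
    by rewrite -qE e2 ea mul0r subr0 oppr0.
  have p1 : p = 1 by apply/eqP; rewrite -subr_eq0 -sqrf_eq0 pp.
  exists a => //; split=> //; rewrite A3 qE p1.
  have -> : 1 * - (a * (a + 1)) = 1 - (a ^+ 2 + a + 1) by ring.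
  by rewrite ea subr0 invr1.
have : (A - 1) * (A - w) * (A - w ^+ 2) = 0.
  have -> : (A - 1) * (A - w) * (A - w ^+ 2) =
    A ^+ 3 - 1 + (w ^+ 2 + w + 1) * (w * A - A ^+ 2 - (w - 1)) by ring.
  by rewrite A31 w3; ring.
move/eqP; rewrite !mulf_eq0 !subr_eq0 (negPf nA) /= => /orP[]/eqP AE.
- by apply: nKA; rewrite AE.
- by apply: nKA; rewrite AE; apply: KM.
Qed.

(** Otherwise [A] would be alone in its class, since [B^-1 / A = C] and [C^-1 / A = B] are not
    central, and its coefficient [a] would vanish. *)
Lemma triple_match a b A B C :
  triple a b A B C -> ~ K A -> ~ K B -> ~ K C ->
  [\/ K (A ^+ 2), K (B / A) | K (C / A)].
Proof.
case=> [[HA HB HC] [Ka Kb] [ca cb] [nA nB nC] [e r]] nKA nKB nKC.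
have [A0 B0] := (HnF0 HA, HnF0 HB).
have [a0 b0] := (conj_scales_neq0 HA ca, conj_scales_neq0 HB cb).
have C0 := HnF0 HC.
have eC : C = (A * B)^-1.
  by apply: (mulfI (mulf_neq0 A0 B0)); rewrite e divff ?mulf_neq0.
apply: contrapT => h.
have nA2 : ~ K (A ^+ 2) by move=> k; apply: h; constructor 1.
have nBA : ~ K (B / A) by move=> k; apply: h; constructor 2.
have nCA : ~ K (C / A) by move=> k; apply: h; constructor 3.
move/eqP: a0; apply.
apply: (@isolate_class_field
  [:: (-1, A^-1); (1, B); (- b^-1, B^-1); (b^-1, C); (- a, C^-1)] _ A) => //.
- move=> p; rewrite !inE => /or4P[|||/orP[]] /eqP-> /=; split=> //.
  + exact: HfV.
  + by rewrite -invfM => /KVE.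
  + exact: KN (KV Kb).
  + exact: HfV.
  + by rewrite -invfM mulrC -eC.
  + exact: KV.
  + exact: KN.
  + exact: HfV.
  + by rewrite eC invrK mulrAC divff ?mul1r.
- by rewrite !big_cons big_nil /= -[RHS]r; ring.
Qed.

(** By [triple_cube], [C] is outside the class of [A]. Separating [A] and [A^-1] then gives
    [B = - a A] and [b^-1 = a], which reduces the relation to [C^2 = 1], so that [C] is 1 or -1. *)
Lemma triple_pair a b A B C :
  triple a b A B C -> ~ K A -> ~ K B -> ~ K C -> ~ K (B / A).
Proof.
move=> tr nKA nKB nKC; have := tr.
case=> [[HA HB HC] [Ka Kb] [ca cb] [nA nB nC] [e r]] KBA.
have [A0 B0] := (HnF0 HA, HnF0 HB).
have [a0 b0] := (conj_scales_neq0 HA ca, conj_scales_neq0 HB cb).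
have C0 := HnF0 HC.
have eC : C = (A * B)^-1.
  by apply: (mulfI (mulf_neq0 A0 B0)); rewrite e divff ?mulf_neq0.
have [KCA|nKCA] := EM (K (C / A)); first exact: (triple_cube tr).
move: KBA; set p := B / A => Kp.
have BE : B = p * A by rewrite /p mulfVK.
have p0 : p != 0 by rewrite /p mulf_neq0 ?invr_neq0.
clearbody p.
have nKA2 : ~ K (A^-1 / A).
  rewrite -invfM => /KVE KA2; apply: nKC; rewrite eC BE; apply: KV.
  by rewrite mulrCA; apply: KM.
have nKAC : ~ K (C^-1 / A) by rewrite eC invrK mulrAC divff ?mul1r.
have e1 : a + p = 0.
  apply: (@isolate_class_field
    [:: (- (1 + b^-1 * p^-1), A^-1); (b^-1, C); (- a, C^-1)] _ A) => //.
  - exact: KD.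
  - move=> u; rewrite !inE => /or3P[] /eqP-> /=; split=> //.
    + by apply: KN; apply: KD K1 (KM (KV Kb) (KV Kp)).
    + exact: HfV.
    + exact: KV.
    + exact: KN.
    + exact: HfV.
  - by rewrite !big_cons big_nil /= -[RHS]r BE; field; rewrite C0 A0 b0 p0.
have e2 : - (1 + b^-1 * p^-1) = 0.
  apply: (@isolate_class_field
    [:: (a + p, A); (b^-1, C); (- a, C^-1)] _ A^-1) => //.
  - by apply: KN; apply: KD K1 (KM (KV Kb) (KV Kp)).
  - exact: HfV.
  - move=> u; rewrite !inE => /or3P[] /eqP-> /=; split=> //.
    + exact: KD.
    + by rewrite invrK => h; apply: nKA2; rewrite -invfM; apply: KV.
    + exact: KV.
    + by rewrite invrK => h; apply: nKAC; rewrite -invfM; apply: KV.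
    + exact: KN.
    + exact: HfV.
    + by rewrite -invfM => /KVE.
  - by rewrite !big_cons big_nil /= -[RHS]r BE; field; rewrite C0 A0 b0 p0.
have pE : p = - a by apply/eqP; rewrite -addr_eq0 addrC e1.
have bE : b^-1 = a.
  move/eqP: e2; rewrite pE invrN mulrN oppr_eq0 subr_eq0 => /eqP e2.
  by rewrite -(mulfVK a0 b^-1) -e2 mul1r.
have : C ^+ 2 == 1.
  rewrite -subr_eq0 -(inj_eq (mulfI a0)) mulr0 -(mulr0 C) -r bE BE pE; apply/eqP.
  by field; rewrite C0 A0 oppr_eq0 a0.
by rewrite sqrf_eq1 (negPf nC) => /eqP CE; apply: nKC; rewrite CE.
Qed.

(** If none is central, [triple_match] and [triple_pair] make all three squares central. The three
    eigenvalues are then -1, although their product is 1. *)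
Lemma triple_some_central a b A B C :
  triple a b A B C -> [\/ K A, K B | K C].
Proof.
move=> tr; have tr1 := triple_rot tr; have tr2 := triple_rot tr1.
have [|nKA] := EM (K A); first by constructor 1.
have [|nKB] := EM (K B); first by constructor 2.
have [|nKC] := EM (K C); first by constructor 3.
have nBA := triple_pair tr nKA nKB nKC.
have nCB := triple_pair tr1 nKB nKC nKA.
have nAC := triple_pair tr2 nKC nKA nKB.
have sw u v : ~ K (u / v) -> ~ K (v / u).
  by move=> h k; apply: h; apply: KVE; rewrite invfM invrK mulrC.
have [KA2|//|/(sw _ _ nAC)//] := triple_match tr nKA nKB nKC.
have [KB2|//|/(sw _ _ nBA)//] := triple_match tr1 nKB nKC nKA.
have [KC2|//|/(sw _ _ nCB)//] := triple_match tr2 nKC nKA nKB.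
have [a1 na] := triple_involutive tr nKA nKB nKC KA2 nBA (sw _ _ nAC).
have [b1 _] := triple_involutive tr1 nKB nKC nKA KB2 nCB (sw _ _ nBA).
have [c1 _] := triple_involutive tr2 nKC nKA nKB KC2 nAC (sw _ _ nCB).
by case: na; rewrite a1 -c1 a1 b1 mulrNN mulr1 invr1.
Qed.

End Triple.

(** Conjugating the relation by [b] gives [g - l c g - 1 + c = 0] with [g = b x b^-1 x^-1] in [H]
    and [l = b c b^-1 c^-1]. If [l] is not 1, separating classes forces [g = - c], so [l c^2 = 1]
    and then [l = -1]. *)
Lemma commute_or_anticommute x b c :
  G x -> H b -> H c -> (1 - c) * x = b - 1 ->
  b * c = c * b \/ c * c = -1 /\ b * c = - (c * b).
Proof.
move=> Gx Hb Hc e; pose l := b * c * b^-1 * c^-1.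
have Kl : comm_all G l by apply: HHK.
have bc : b * c = l * c * b by rewrite /l mulrVK ?Hu // mulrVK ?Hu.
clearbody l; have [l1|l1] := EM (l = 1); first by left; rewrite bc l1 mul1r.
have nKc : ~ comm_all G c.
  move=> Kc; apply: l1; apply: (mulIr (Hu (HM Hc Hb))).
  by rewrite mulrA -bc mul1r Kc //; apply: HG.
pose g := b * (x * b^-1 * x^-1).
have Hg : H g by apply/HM/hN/HV.
have bx : b * x = g * x * b by rewrite /g !mulrA mulrVK ?Gu // mulrVK ?Hu.
clearbody g.
have eg : (1 - l * c) * g = 1 - c.
  apply: (mulIr (Gu Gx)); apply: (mulIr (Hu Hb)).
  have b1 : b * (1 - c) = (1 - l * c) * b by rewrite mulrBr mulrBl mul1r mulr1 bc.
  rewrite e -!mulrA [g * _]mulrA -bx mulrA -b1 -mulrA e.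
  by rewrite mulrBr mulrBl mulr1 mul1r.
have {}eg : g - l * (c * g) - 1 + c = 0.
  by rewrite -[RHS](subrr (1 - c)) -{1}eg mulrBl mul1r mulrA opprB [c - 1]addrC !addrA.
have [Kg|nKg] := EM (comm_all G g).
  have g1 : g - 1 = 0.
    apply: (@isolate_class [:: (1 - l * g, c)] _ 1) => //.
    - exact/comm_allB/comm_all1.
    - move=> p; rewrite inE => /eqP-> /=; rewrite divr1; split=> //.
      exact/comm_allB/comm_allM/Kg/Kl/comm_all1.
    - apply: etrans eg; rewrite big_seq1 /= mulr1 mulrBl mul1r -mulrA (Kg c); last exact: HG.
      by rewrite addrA [LHS]addrAC [X in X + _ = _]addrAC.
  move/eqP: g1; rewrite subr_eq0 => /eqP g1; case: l1.
  move/eqP: eg; rewrite g1 mulr1 [1 - _]addrC addrK addrC subr_eq0 => /eqP cl.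
  by apply: (mulIr (Hu Hc)); rewrite mul1r -cl.
have nK1g : ~ comm_all G (1 * g^-1).
  by rewrite mul1r => /comm_allV; rewrite invrK.
have nKcgg : ~ comm_all G (c * g / g) by rewrite mulrK ?Hu.
have [Kz|nKz] := EM (comm_all G (c / g)); last first.
  move/eqP: (oner_neq0 D); case; apply: (@isolate_class [:: (- l, c * g); (-1, 1); (1, c)] _ g) => //.
  - exact: comm_all1.
  - move=> p; rewrite !inE => /or3P[] /eqP-> /=; split=> //.
    + exact: comm_allN.
    + exact: HM.
    + exact/comm_allN/comm_all1.
    + exact: comm_all1.
  - by rewrite !big_cons big_nil /= !mul1r addr0 mulr1 mulNr !addrA -[RHS]eg.
have z1 : 1 + c / g = 0.
  apply: (@isolate_class [:: (- l, c * g); (-1, 1)] _ g) => //.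
  - exact/comm_allD/Kz/comm_all1.
  - move=> p; rewrite !inE => /orP[] /eqP-> /=; split=> //.
    + exact: comm_allN.
    + exact: HM.
    + exact/comm_allN/comm_all1.
  - rewrite !big_cons big_nil /= addr0 mulr1 mulNr mulrDl mul1r mulrVK ?Hu //.
    by rewrite -[RHS]eg -!addrA [c + _]addrC -!addrA.
have gE : g = - c.
  have : (1 + c / g) * g = 0 by rewrite z1 mul0r.
  by rewrite mulrDl mul1r mulrVK ?Hu // => /eqP; rewrite addr_eq0 => /eqP.
have lcc : l * (c * c) = 1.
  apply/eqP; rewrite -subr_eq0 -[X in _ == X]eg gE !mulrN opprK.
  by rewrite [- c + _]addrC [X in _ == X]addrAC subrK.
have ll : l * l = 1.
  apply: (mulIr (Hu Hb)); rewrite mul1r -[RHS]mulr1 -lcc [RHS]mulrA -(Kl b); last exact: HG.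
  rewrite -[RHS]mulrA [b * (c * c)]mulrA bc -[_ * b * c]mulrA bc -[l * c * _]mulrA.
  rewrite [c * (l * c * b)]mulrA [c * (l * c)]mulrA -(Kl c); last exact: HG.
  by rewrite -[l * c * c]mulrA lcc mul1r mulrA.
have lN1 : l = -1.
  have : (l - 1) * (l + 1) = 0.
    by rewrite mulrDr mulr1 mulrBl mul1r ll -[1 - l]opprB addNr.
  case/(division_mul_eq0 hD) => /eqP; first by rewrite subr_eq0 => /eqP.
  by rewrite addr_eq0 => /eqP.
right; split; last by rewrite bc lN1 mulN1r mulNr.
by rewrite -lcc lN1 mulN1r opprK.
Qed.

(** The relation has a twin for [x^-1], with [x^-1 c x] and [x^-1 b x] in place of [b] and [c], so
    [b^2 = -1] as well as [c^2 = -1]. Multiplying the relation by [1 + c] gives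
    [2 x + 1 = b + c b - c], whose square is -3. *)
Lemma quaternion_exceptional x b c :
  G x -> H b -> H c -> (1 - c) * x = b - 1 -> b * c <> c * b -> exceptional x.
Proof.
move=> Gx Hb Hc e nbc; have ux := Gu Gx.
have [//|[cc bc]] := commute_or_anticommute Gx Hb Hc e.
have bb : b * b = -1.
  have hJ h : H h -> H (x^-1 * h * x).
    by move=> Hh; have := hN (GV Gx) Hh; rewrite invrK.
  have e' : (1 - x^-1 * b * x) * x^-1 = x^-1 * c * x - 1.
    apply: (mulrI ux); rewrite mulrBl mul1r !mulrBr mulr1 mulrV // -!mulrA mulrV // mulr1.
    by rewrite !(mulVKr ux) -opprB -e mulrBl mul1r opprB.
  have [|[bb _]] := commute_or_anticommute (GV Gx) (hJ _ Hc) (hJ _ Hb) e'.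
    rewrite !mulrA !mulrK // => h; case: nbc; apply: (mulIr ux); apply: (mulrI (Gu (GV Gx))).
    by rewrite !mulrA.
  move: bb; rewrite !mulrA mulrK // => /(congr1 (fun z => x * z * x^-1)).
  by rewrite !mulrA mulrV // mul1r mulrK // mulrN1 mulNr mulrV.
have two0 : (2 : D) != 0.
  apply/eqP => t2; have N1 : -1 = 1 :> D.
    by apply/eqP; rewrite eq_sym -addr_eq0 -[1 + 1]/(2%:R) t2.
  have : (c - 1) * (c + 1) = 0.
    by rewrite mulrDr mulr1 mulrBl mul1r cc addrA subrK -opprD -[1 + 1]/(2%:R) t2 oppr0.
  case/(division_mul_eq0 hD) => /eqP; rewrite ?subr_eq0 ?addr_eq0 ?N1 => /eqP c1;
    by apply: nbc; rewrite c1 mul1r mulr1.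
split=> //; constructor 1.
have s1 : 2 * x = b + c * b - c - 1.
  have -> : 2 * x = (1 + c) * ((1 - c) * x).
    by rewrite mulrA mulrBr mulr1 [(1 + c) * c]mulrDl mul1r cc opprD opprK addrA addrK.
  by rewrite e mulrBr mulr1 mulrDl mul1r opprD [- 1 - c]addrC addrA.
have s2 : (2 * x + 1) * (2 * x + 1) = - 3.
  have ub : c * b * b = - c by rewrite -mulrA bb mulrN1.
  have bu : b * (c * b) = c by rewrite mulrA bc mulNr ub opprK.
  have uu : c * b * (c * b) = -1 by rewrite -mulrA bu cc.
  have cu : c * (c * b) = - b by rewrite mulrA cc mulN1r.
  have uc : c * b * c = b by rewrite -mulrA bc mulrN cu opprK.
  rewrite s1 subrK mulrBr !mulrDr !mulrBl !mulrDl bb ub bu uu cu uc cc bc.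
  rewrite !opprK !opprD opprK.
  rewrite [LHS](AC (3*3*3) ((2*4)*(3*7)*(6*8)*(1*5*9)))%AC /=.
  by rewrite !addNr subrr !add0r -!opprD -addrA.
have : 2 * 2 * (x ^+ 2 + x + 1) = 0.
  have -> : 2 * 2 * (x ^+ 2 + x + 1) = (2 * x + 1) * (2 * x + 1) + 3.
    rewrite -natrM !mulr_natl !mulrnDl mulrDr mulr1 mulrDl mul1r.
    rewrite mulrnAl mulrnAr -mulrnA -expr2 [x *+ (2 * 2)]mulrnA [x *+ 2 *+ 2]mulr2n.
    by rewrite !addrA.
  by rewrite s2 addNr.
case/(division_mul_eq0 hD) => [/(division_mul_eq0 hD)[]|//] /eqP; by rewrite (negPf two0).
Qed.

(** Here [x], [b], [c] and the commutators of [y] with [b] and [c] all commute. In a field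
    containing them, conjugating the relation by [y] and eliminating [X] yields a [triple]. Its
    central member is -1 and the next one squares to -1; the three positions give the last three
    quadratics of [exceptional]. *)
Lemma commuting_exceptional x y a b c :
  G x -> H y -> H b -> H c -> (1 - c) * x = b - 1 -> b * c = c * b ->
  a * x * y = y * x -> a * b = c -> a <> 1 -> b <> 1 -> c <> 1 -> exceptional x.
Proof.
move=> Gx Hy Hb Hc e bc ax ab na nb nc.
have u1c : 1 - c \is a GRing.unit.
  by apply: hD; rewrite subr_eq0; apply/eqP => c1; apply: nc.
have xb : x * b = b * x.
  have b1 : b * (1 - c) = (1 - c) * b by rewrite mulrBr mulrBl mul1r mulr1 bc.
  by apply: (mulrI u1c); rewrite !mulrA -b1 -[in RHS]mulrA e mulrBl mulrBr mul1r mulr1.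
have xc : x * c = c * x.
  have c1 : c * (1 - c) = (1 - c) * c by rewrite mulrBr mulrBl mul1r mulr1.
  by apply: (mulrI u1c); rewrite !mulrA -c1 -[in RHS]mulrA e mulrBl mulrBr mul1r mulr1 bc.
pose n := y * b * y^-1 * b^-1; pose k := y * c * y^-1 * c^-1.
have [Kn Kk] : comm_all G n /\ comm_all G k by split; apply: HHK.
have [Gn Gk] : G n /\ G k.
  by split; apply: HG; do 2?apply: HM; do ?apply: HV => //; apply: HM.
have nE : y * b = n * b * y by rewrite /n mulrVK ?Hu // mulrVK ?Hu.
have kE : y * c = k * c * y by rewrite /k mulrVK ?Hu // mulrVK ?Hu.
clearbody n k.
have abel : abelian_set (fun z => z \in [:: x; b; c; n; k]).
  move=> u v; rewrite !inE.
  have [Gb Gc] := (HG Hb, HG Hc).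
  by do 2![case/or4P => [|||/orP[]] /eqP->];
    rewrite ?xb ?xc ?bc ?(Kn x) ?(Kn b) ?(Kn c) ?(Kn k) ?(Kk x) ?(Kk b) ?(Kk c) ?(Kk n).
have [F [f fS]] := abelian_set_in_field hD abel.
have [[X fX] [B fB] [C fC] [N fN] [k' fK]] :
  [/\ exists X, f X = x, exists B, f B = b, exists C, f C = c,
      exists N, f N = n & exists K, f K = k].
  by split; apply: fS; rewrite !inE eqxx ?orbT.
have nz u : H (f u) -> u != 0.
  by move/Hu; apply: contraTneq => ->; rewrite rmorph0 unitr0.
have [B0 C0] : B != 0 /\ C != 0 by split; apply: nz; rewrite ?fB ?fC.
have aE : a = f (C / B) by rewrite rmorphM fmorphV fB fC -ab mulrK ?Hu.
have sB : conj_scales f y N B by rewrite /conj_scales rmorphM fB fN.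
have sC : conj_scales f y k' C by rewrite /conj_scales rmorphM fC fK.
have sA : conj_scales f y (k' / N) (C / B).
  by apply: conj_scalesM => //; apply: conj_scalesV.
have [N0 k0] : N != 0 /\ k' != 0.
  by split; [apply: (conj_scales_neq0 Hy _ sB) | apply: (conj_scales_neq0 Hy _ sC)];
    rewrite ?fB ?fC.
have E1 : (1 - C) * X = B - 1.
  by apply: (fmorph_inj f); rewrite rmorphM !rmorphB !rmorph1 fX fB fC.
have E2 : (1 - k' * C) * (C / B * X) = N * B - 1.
  apply: (fmorph_inj f); apply: (mulIr (Hu Hy)).
  rewrite rmorphM [f (_ * X)]rmorphM -aE fX -mulrA ax mulrA.
  rewrite rmorphB rmorph1 mulrBl mul1r -sC fC -{1}[y]mulr1 -mulrBr -mulrA e.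
  by rewrite rmorphB rmorph1 mulrBl mul1r -sB fB mulrBr mulr1.
have nC1 : 1 - C != 0.
  by apply: contra_not_neq nc => c1; rewrite -fC -(subr0_eq c1) rmorph1.
have XE : X = (B - 1) / (1 - C) by rewrite -E1 mulrC mulKf.
have tr : triple f y (k' / N) N (C / B) B C^-1.
  split.
  - by rewrite -aE fB fmorphV fC -[a](mulrK (Hu Hb)) ab; split=> //; [apply: HM => //|]; apply: HV.
  - by rewrite rmorphM fmorphV fN fK; split=> //; apply: comm_allM => //; apply: comm_allV.
  - by split.
  - split; first by apply: contra_not_neq na => A1; rewrite aE A1 rmorph1.
    + by apply: contra_not_neq nb => B1; rewrite -fB B1 rmorph1.
    + by apply: contra_not_neq nc => C1; rewrite -fC -[C]invrK C1 invr1 rmorph1.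
  - split; first by field; rewrite B0 C0.
    have : (1 - k' * C) * (C / B * X) - (N * B - 1) = 0 by rewrite E2 subrr.
    rewrite XE => E3.
    apply: (mulfI (mulf_neq0 (mulf_neq0 N0 C0) B0)); rewrite mulr0 -[RHS](mulr0 (B * (1 - C))) -E3.
    by field; rewrite B0 C0 N0 nC1 oner_neq0.
have f2 : f 2 = 2 by rewrite rmorph_nat.
have N1 : (-1 : F) != 1 -> (2 : F) != 0.
  by apply: contraNneq => t; rewrite -subr_eq0 -opprD oppr_eq0 -[1 + 1]/(2%:R) t.
have fin (P : Prop) : P -> (2 : F) != 0 -> P /\ (2 : D) != 0.
  by move=> p t; split=> //; rewrite -f2 fmorph_eq0.
have [KA|KB|KC] := triple_some_central Hy tr.
- have [A1 B2] := triple_central Hy tr KA.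
  have CE : C = - B by rewrite -(mulfVK B0 C) A1 mulN1r.
  have two : (2 : F) != 0 by apply: N1; rewrite -A1 -(inj_eq (fmorph_inj f)) -aE rmorph1; apply/eqP.
  suff : X ^+ 2 + 1 = 0.
    move/(congr1 f); rewrite rmorphD rmorph1 rmorphXn fX rmorph0 => e0.
    by split; [rewrite -f2 fmorph_eq0 | constructor 2].
  apply: (mulfI (mulf_neq0 two B0)); rewrite mulr0.
  have -> : 2 * B * (X ^+ 2 + 1) = ((1 - C) * X - (B - 1)) * ((1 + B) * X + (B - 1))
     - (B ^+ 2 + 1) * (X ^+ 2 - 1) by rewrite CE; ring.
  by rewrite E1 subrr mul0r B2 addNr mul0r subrr.
- have [B1] := triple_central Hy (triple_rot Hy tr) KB.
  rewrite exprVn => /(congr1 (fun z => z^-1)); rewrite invrK invrN1 => C2.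
  have two : (2 : F) != 0 by apply: N1; rewrite -B1 -(inj_eq (fmorph_inj f)) fB rmorph1; apply/eqP.
  suff : (1 + X) ^+ 2 + 1 = 0.
    move/(congr1 f); rewrite rmorphD rmorphXn rmorphD rmorph1 fX rmorph0 => e0.
    by split; [rewrite -f2 fmorph_eq0 | constructor 3].
  apply: (mulfI (mulf_neq0 two C0)); rewrite mulr0.
  have -> : 2 * C * ((1 + X) ^+ 2 + 1) =
     - ((1 - C) * X + 2) * ((1 - C) * X - 2 * C)
     + (C ^+ 2 + 1) * ((1 + X) ^+ 2 - 1) by ring.
  by rewrite E1 B1 C2; ring.
- have [C1 A2] := triple_central Hy (triple_rot Hy (triple_rot Hy tr)) KC.
  have CE : C = -1 by rewrite -[C]invrK C1 invrN1.
  have two : (2 : F) != 0 by apply: N1; rewrite -CE -(inj_eq (fmorph_inj f)) fC rmorph1; apply/eqP.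
  have B2 : B ^+ 2 = -1.
    move: A2; rewrite CE mulN1r sqrrN exprVn => /(congr1 (fun z => z^-1)).
    by rewrite invrK invrN1.
  suff : 2 * X ^+ 2 + 2 * X + 1 = 0.
    move/(congr1 f); rewrite !rmorphD [f (_ * _ ^+ 2)]rmorphM [f (2 * X)]rmorphM rmorphXn f2 rmorph1 fX rmorph0.
    move=> e0.
    by split; [rewrite -f2 fmorph_eq0 | constructor 4].
  have X2 : 2 * X = B - 1 by rewrite -E1 CE opprK.
  apply: (mulfI two); rewrite mulr0.
  have -> : 2 * (2 * X ^+ 2 + 2 * X + 1) = (2 * X) ^+ 2 + 2 * (2 * X) + 2 by ring.
  have -> : (2 * X) ^+ 2 + 2 * (2 * X) + 2 = B ^+ 2 + 1 by rewrite X2; ring.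
  by rewrite B2 addNr.
Qed.

(** Comparing [x y = a y x] with [(1 + x) y = b y (1 + x)] gives [(1 - b a^-1) x = b - 1]. Whether
    or not [b] commutes with [b a^-1], one of the two preceding lemmas makes [x] exceptional. *)
Lemma nonexceptional_centralises x y :
  G x -> G (1 + x) -> ~ exceptional x -> H y -> x * y = y * x.
Proof.
move=> Gx Gx1 nex Hy; apply: contra_notP nex => nxy.
have [[ux u1] uy] := (Gu Gx, Gu Gx1, Hu Hy).
pose a := x * y * x^-1 * y^-1; pose b := (1 + x) * y * (1 + x)^-1 * y^-1.
have Ha : H a by apply/HM/HV => //; apply: hN.
have Hb : H b by apply/HM/HV => //; apply: hN.
have aE : a * y * x = x * y by rewrite /a mulrVK // mulrVK.
have bE : b * y * (1 + x) = (1 + x) * y by rewrite /b mulrVK // mulrVK.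
clearbody a b.
have ua := Hu Ha.
have na : a <> 1 by move=> a1; apply: nxy; rewrite -aE a1 mul1r.
have nb : b <> 1.
  move=> b1; apply: nxy; move: bE; rewrite b1 mul1r mulrDr mulrDl mulr1 mul1r.
  by move/addrI.
have axy : a^-1 * x * y = y * x by rewrite -mulrA -aE -mulrA mulKr.
have e0 : y + a * y * x = b * y + b * y * x.
  by rewrite aE -[X in _ = X + _]mulr1 -mulrDr bE mulrDl mul1r.
have e : (1 - b * a^-1) * x = b - 1.
  apply: (mulIr uy); have -> : 1 - b * a^-1 = (a - b) * a^-1 by rewrite mulrBl mulrV.
  rewrite -!mulrA [a^-1 * _]mulrA axy !mulrBl mul1r !mulrA (canRL (addKr y) e0).
  by rewrite addrA addrK addrC.
have nc : b * a^-1 <> 1.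
  move=> c1; have ba : b = a by rewrite -[b](mulrVK ua) c1 mul1r.
  apply: na; apply: (mulIr uy); rewrite mul1r.
  by move: e0; rewrite ba => /addIr.
have [bc|nbc] := EM (b * (b * a^-1) = b * a^-1 * b); last first.
  by apply: quaternion_exceptional e nbc => //; apply/HM/HV.
apply: (@commuting_exceptional x y a^-1 b (b * a^-1)) => //.
- exact/HM/HV.
- by apply: (mulrI (Hu Hb)); rewrite bc mulrA.
- by move=> a1; apply: na; rewrite -[a]invrK a1 invr1.
Qed.
End Commutators.

(** * Generated subgroups, derived series and Hua's trick *)

Section Subgroups.
Variable D : unitRingType.
Implicit Types G H S : D -> Prop.

Lemma subgroup_units : is_subgroup (fun x : D => x \is a GRing.unit).
Proof.
split=> //; first exact: unitr1.
- by move=> x y ux uy; rewrite unitrMl.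
- by move=> x; rewrite unitrV.
Qed.

Lemma sub_gen S x : S x -> gen S x.
Proof. by move=> Sx H _; apply. Qed.

Lemma gen_subgroup S : (forall x, S x -> x \is a GRing.unit) -> is_subgroup (gen S).
Proof.
move=> Su; split.
- by move=> x gx; apply: (gx _ subgroup_units).
- by move=> H [].
- by move=> x y gx gy H hH SH; case: (hH) => _ _ + _; apply; [apply: gx | apply: gy].
- by move=> x gx H hH SH; case: (hH) => _ _ _; apply; apply: gx.
Qed.

Definition normalised G H := forall g h, G g -> H h -> H (g * h * g^-1).

Lemma subgroup_preconj H g : is_subgroup H -> g \is a GRing.unit ->
  is_subgroup (fun x => H (g * x * g^-1)).
Proof.
case=> Hu H1 HM HV ug; split.
- by move=> x /Hu; rewrite unitrMl ?unitrV // unitrMr.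
- by rewrite mulr1 mulrV.
- move=> x y hx hy; have := HM _ _ hx hy.
  by rewrite !mulrA mulrVK.
- move=> x hx; have ux : x \is a GRing.unit.
    by have := Hu _ hx; rewrite unitrMl ?unitrV // unitrMr.
  by have := HV _ hx; rewrite !invrM ?unitrMl ?unitrV // invrK mulrA.
Qed.

Lemma derived_normal G H : is_subgroup G -> is_subgroup H -> normalised G H ->
  [/\ is_subgroup (derived H), forall x, derived H x -> H x &
      normalised G (derived H)].
Proof.
move=> hG hH nGH; have [Gu _ _ GV] := hG; have [Hu H1 HM HV] := hH.
have cH z : (exists x y, [/\ H x, H y & z = gcomm x y]) -> H z.
  by move=> [x [y [hx hy ->]]]; apply: (HM _ _ (HM _ _ (HM _ _ (HV _ hx) (HV _ hy)) hx) hy).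
split.
- by apply: gen_subgroup => z /cH /Hu.
- by move=> x; apply.
- move=> g h Gg dh; have ug := Gu _ Gg.
  (* Minimality of [gen] is applied to the preimage of [derived H] under conjugation by [g]. *)
  apply: (dh (fun z => derived H (g * z * g^-1))).
    apply: subgroup_preconj => //.
    by apply: gen_subgroup => z /cH /Hu.
  move=> _ [x [y [hx hy ->]]]; apply: sub_gen.
  exists (g * x * g^-1), (g * y * g^-1); split; try exact: nGH.
  have [ux uy] := (Hu _ hx, Hu _ hy).
  by rewrite /gcomm !invrM ?unitrMl ?unitrV // !invrK !mulrA !mulrVK.
Qed.

Lemma iter_derived_normal G n : is_subgroup G ->
  [/\ is_subgroup (iter n (@derived D) G), forall x, iter n (@derived D) G x -> G x &
      normalised G (iter n (@derived D) G)].
Proof.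
move=> hG; elim: n => [|n [h1 h2 h3]] /=.
  split=> // g h Gg Gh; have [_ _ GM GV] := hG.
  by apply: (GM) (GM _ _ _ _) (GV _ _).
have [d1 d2 d3] := derived_normal hG h1 h3.
by split=> // x /d2 /h2.
Qed.

Lemma centraliser_subgroup (S : D -> Prop) :
  is_subgroup (fun z => z \is a GRing.unit /\ comm_all S z).
Proof.
split.
- by move=> x [].
- by split; [exact: unitr1 | move=> u _; rewrite mul1r mulr1].
- move=> x y [ux hx] [uy hy]; split; first by rewrite unitrMl.
  by move=> u Su; rewrite -mulrA hy // mulrA hx // mulrA.
- move=> x [ux hx]; split; first by rewrite unitrV.
  by move=> u Su; apply/esym/commrV/esym/hx.
Qed.

(* Hua's trick: if [x y = y1 x] and [(1 + x) y = y2 (1 + x)] with [y1 <> y2],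
   then [x = (y2 - y1)^-1 (y - y2)]. *)
Lemma hua_trick (x y y1 y2 : D) : is_division_ring D ->
  x * y = y1 * x -> (1 + x) * y = y2 * (1 + x) ->
  x * y = y * x \/ exists2 w, (y2 - y1) * w = 1 & x = w * (y - y2).
Proof.
move=> hD e1; rewrite mulrDl mulrDr mul1r mulr1 e1 => e2.
have [y12|n12] := eqVneq y2 y1.
  by left; move: e2; rewrite y12 => /addIr <-.
right; have u : y2 - y1 \is a GRing.unit by apply: hD; rewrite subr_eq0.
exists (y2 - y1)^-1; first exact: mulrV.
apply: (mulrI u); rewrite mulVKr // mulrBl.
by apply/eqP; rewrite subr_eq addrAC eq_sym subr_eq e2 addrC.
Qed.

(** If [x] and [y] did not commute, Hua's trick would express [x] through [y] and two conjugates of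
    it; these lie in [A], so [x] would commute with [y] after all. *)
Lemma abelian_normal_commute G (A : D -> Prop) x y : is_division_ring D ->
  is_subgroup G -> normalised G A -> abelian_set A ->
  G x -> G (1 + x) -> A y -> x * y = y * x.
Proof.
move=> hD [Gu _ _ _] nA abA Gx Gx1 Ay.
have [Ay1 Ay2] := (nA _ _ Gx Ay, nA _ _ Gx1 Ay).
have [||//|[w w1 xE]] := @hua_trick x y (x * y * x^-1) ((1 + x) * y * (1 + x)^-1) hD.
- by rewrite mulrVK // Gu.
- by rewrite mulrVK // Gu.
have comB u v : A u -> A v -> (u - v) * y = y * (u - v).
  by move=> Au Av; rewrite mulrBl mulrBr (abA u) // (abA v).
set d := (_ - _) in w1.
have wy : w * y = y * w.
  have ud : d \is a GRing.unit.
    by apply: hD; apply/eqP => d0; move/eqP: w1; rewrite d0 mul0r eq_sym oner_eq0.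
  have -> : w = d^-1 by rewrite -[w](mulKr ud) w1 mulr1.
  by apply/esym/commrV; rewrite /GRing.comm comB.
by rewrite xE -mulrA comB // mulrA wy mulrA.
Qed.

Lemma solvable_commute (x y : D) : is_division_ring D ->
  ~ exceptional x -> ~ exceptional y ->
  x != 0 -> 1 + x != 0 -> y != 0 -> 1 + y != 0 ->
  solvable_grp (gen (fun z => z \in [:: x; 1 + x; y; 1 + y])) -> x * y = y * x.
Proof.
move=> hD nx ny x0 x1 y0 y1; set G := gen _ => -[n solG].
have hG : is_subgroup G.
  by apply: gen_subgroup => z; rewrite !inE => /or4P[] /eqP->; apply: hD.
have [[Gx Gx1] [Gy Gy1]] : (G x /\ G (1 + x)) /\ (G y /\ G (1 + y)).
  by split; split; apply: sub_gen; rewrite !inE eqxx ?orbT.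
have [Gu _ GM GV] := hG.
have cG h : x * h = h * x -> y * h = h * y -> comm_all G h.
  move=> xh yh g Gg; have := centraliser_subgroup (eq h) => /Gg [].
    move=> z; rewrite !inE => /or4P[] /eqP->; (split; first exact: hD) => _ <-;
    by rewrite ?mulrDl ?mulrDr ?mul1r ?mulr1 ?xh ?yh.
  by move=> _ /(_ h) ->.
have step i : (forall z, iter i.+1 (@derived D) G z -> comm_all G z) ->
    forall z, iter i (@derived D) G z -> comm_all G z.
  have [hH HG nH] := iter_derived_normal i hG.
  rewrite /=; set H := iter i _ G in hH HG nH * => dK.
  have [Hu H1 HM HV] := hH.
  have HHK u v : H u -> H v -> comm_all G (u * v * u^-1 * v^-1).
    move=> hu hv; apply: dK; apply: sub_gen.
    by exists u^-1, v^-1; split; rewrite /gcomm ?invrK //; apply: HV.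
  (* The center of [H] is an abelian normal subgroup, so Hua's trick makes it commute with [x] and
     [y], hence with [G]. *)
  pose A u := H u /\ comm_all H u.
  have abA : abelian_set A by move=> u v [_ hu] [hv _]; apply: hu.
  have nA : normalised G A.
    move=> g u Gg [hu cu]; split; first exact: nH.
    move=> v hv; have ug := Gu _ Gg.
    have hv' : H (g^-1 * v * g) by have := nH _ _ (GV _ Gg) hv; rewrite invrK.
    have := congr1 (fun w => g * w * g^-1) (cu _ hv').
    by rewrite !mulrA mulrV // mul1r !mulrK // !mulrA.
  have ZHK u : H u -> comm_all H u -> comm_all G u.
    move=> hu cu; apply: cG.
    - exact: (@abelian_normal_commute G A).
    - exact: (@abelian_normal_commute G A).
  by move=> z Hz; apply: cG; apply: (nonexceptional_centralises hD hG hH HG nH HHK ZHK).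
(* The induction starts at the trivial [n]-th derived subgroup and lowers the index to 0, that is,
   to [G]. *)
have all i : (i <= n)%N -> forall z, iter (n - i)%N (@derived D) G z -> comm_all G z.
  elim: i => [_|i IH ltin].
    by rewrite subn0 => z /solG -> g _; rewrite mul1r mulr1.
  by apply: step; rewrite -subSn // subSS; apply: IH; apply: ltnW.
by have := all n (leqnn n); rewrite subnn => /(_ x Gx y Gy).
Qed.

(** * Escaping the exceptional quadratics *)

Lemma exceptional_square (F : fieldType) (x : F) :
  [\/ x ^+ 2 + x + 1 = 0, x ^+ 2 + 1 = 0, (1 + x) ^+ 2 + 1 = 0
    | 2 * x ^+ 2 + 2 * x + 1 = 0] ->
  exists s t : int, (s \in [:: 0; 1; -1]) /\
    (2 * x + 1) ^+ 2 = 2 * s%:~R * (2 * x + 1) + t%:~R.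
Proof.
have N5 : (-5)%:~R = -5 :> F by rewrite rmorphN.
(* In terms of [w = 2 x + 1] the equations are [w^2 = -3], [(w - 1)^2 = -4], [(w + 1)^2 = -4] and
   [w^2 = -1]. *)
case=> e.
- exists 0, (-3); split=> //; rewrite mulr0z mulr0 mul0r add0r rmorphN /=.
  by apply/eqP; rewrite -subr_eq0 -(mulr0 4) -e; apply/eqP; ring.
- exists 1, (-5); split=> //; rewrite N5 mulr1z.
  by apply/eqP; rewrite -subr_eq0 -(mulr0 4) -e; apply/eqP; ring.
- exists (-1), (-5); split=> //; rewrite N5 mulrN1z.
  by apply/eqP; rewrite -subr_eq0 -(mulr0 4) -e; apply/eqP; ring.
- exists 0, (-1); split=> //; rewrite mulr0z mulr0 mul0r add0r mulrN1z.
  by apply/eqP; rewrite -subr_eq0 -(mulr0 2) -e; apply/eqP; ring.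
Qed.

(* Doubling and shifting turns the exceptional quadratics into
   [w^2 = 2 s w + t] with [s] in {-1,0,1}; the three shifts of [x] would need
   three values of [s] spaced by 2. *)
Lemma shift_nonexceptional (x y : D) : is_division_ring D ->
  (2 : D) != 0 -> (3 : D) != 0 -> x * y <> y * x ->
  exists2 e : D, [\/ e = 0, e = 1 | e = -1] & ~ exceptional (x + e).
Proof.
move=> hD t2 t3 nxy; apply: contrapT => h.
have [F [f fS]] := @abelian_set_in_field D (eq x) hD (fun u v eu ev => etrans (congr2 _ (esym eu) (esym ev)) (congr2 _ ev eu)).
have [X fX] := fS x erefl.
have F2 : (2 : F) != 0 by rewrite -(fmorph_eq0 f) rmorph_nat.
have F3 : (3 : F) != 0 by rewrite -(fmorph_eq0 f) rmorph_nat.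
have exc e E : f E = e -> [\/ e = 0, e = 1 | e = -1] ->
    exists s t : int, (s \in [:: 0; 1; -1]) /\
    (2 * (X + E) + 1) ^+ 2 = 2 * s%:~R * (2 * (X + E) + 1) + t%:~R.
  move=> fE he; apply: exceptional_square.
  have {h} [_ h] : exceptional (x + e) by apply: contrapT => k; apply: h; exists e.
  rewrite -fX -fE -rmorphD in h.
  have f2 : f 2 = 2 by rewrite rmorph_nat.
  case: h => h; [constructor 1 | constructor 2 | constructor 3 | constructor 4];
    apply: (fmorph_inj f); rewrite rmorph0 -[RHS]h.
  - by rewrite [LHS]rmorphD rmorph1 [f (_ ^+ 2 + _)]rmorphD rmorphXn.
  - by rewrite [LHS]rmorphD rmorph1 rmorphXn.
  - by rewrite [LHS]rmorphD rmorphXn [f (1 + _)]rmorphD rmorph1.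
  - by rewrite [LHS]rmorphD rmorph1 [f (_ * _ + _)]rmorphD [f (_ * _ ^+ 2)]rmorphM rmorphXn [f (2 * _)]rmorphM f2.
have [s0 [t0 [hs0 e0]]] := exc 0 0 (rmorph0 f) (Or31 _ _ erefl).
have [s1 [t1 [hs1 e1]]] := exc 1 1 (rmorph1 f) (Or32 _ _ erefl).
have [s2 [t2' [hs2 e2]]] := exc (-1) (-1) (rmorphN1 f) (Or33 _ _ erefl).
(* With a nonzero coefficient, [x] would be a quotient of integers, hence central. *)
have key (m n : int) : m%:~R * (2 * X + 1) = n%:~R :> F -> (m%:~R : F) = 0.
  move=> e; apply: contrapT => /eqP m0; apply: nxy.
  have XE : X = (n - m)%:~R / (2 * m)%:~R.
    have d0 : ((2 * m)%:~R : F) != 0 by rewrite intrM mulf_neq0.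
    by apply: (mulIf d0); rewrite mulfVK // rmorphB /= -e intrM; ring.
  rewrite -fX XE rmorphM fmorphV !rmorph_int.
  by apply/esym/commrM; [|apply: commrV]; apply: commr_int.
rewrite addr0 in e0.
(* Cancelling the squares between the quadratics of [x] and [x + 1] leaves a linear relation in
   [2 X + 1]. *)
have k1 : ((2 * (s0 - s1 + 2))%:~R : F) = 0.
  apply: (key _ (4 * s1 + t1 - 4 - t0)).
  rewrite !(rmorphM, rmorphD, rmorphN) /=.
  have -> : 2%:~R * (s0%:~R - s1%:~R + 2%:~R) * (2 * X + 1) =
    2 * s0%:~R * (2 * X + 1) - (2 * s1%:~R * (2 * (X + 1) + 1))
     + (2 * (X + 1) + 1) ^+ 2 - (2 * X + 1) ^+ 2 + (4 * s1%:~R - 4) :> F by ring.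
  by rewrite e0 e1; ring.
have k2 : ((2 * (s0 - s2 - 2))%:~R : F) = 0.
  apply: (key _ (t2' - 4 * s2 - 4 - t0)).
  rewrite !(rmorphM, rmorphD, rmorphN) /=.
  have -> : 2%:~R * (s0%:~R - s2%:~R - 2%:~R) * (2 * X + 1) =
    2 * s0%:~R * (2 * X + 1) - (2 * s2%:~R * (2 * (X - 1) + 1))
     + (2 * (X - 1) + 1) ^+ 2 - (2 * X + 1) ^+ 2 - (4 * s2%:~R + 4) :> F by ring.
  by rewrite e0 e2; ring.
(* The integers in [k1] and [k2] are even of absolute value at most 8, so they vanish in [F] only if
   zero. That would mean [s1 = s0 + 2] and [s2 = s0 - 2], impossible in {-1, 0, 1}. *)
have n6 : (6 : F) != 0 by rewrite (natrM _ 2 3) mulf_neq0.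
have n4 : (4 : F) != 0 by rewrite (natrM _ 2 2) mulf_neq0.
have n8 : (8 : F) != 0 by rewrite (natrM _ 2 4) mulf_neq0.
have nzN k : (k%:R : F) != 0 -> ((- k%:R : int)%:~R : F) <> 0.
  by move=> k0 /eqP; rewrite rmorphN oppr_eq0 rmorph_nat (negPf k0).
have nzP k : (k%:R : F) != 0 -> ((k%:R : int)%:~R : F) <> 0.
  by move=> k0 /eqP; rewrite rmorph_nat (negPf k0).
move: hs0 hs1 hs2 k1 k2; rewrite !inE.
move=> /or3P[] /eqP-> /or3P[] /eqP-> /or3P[] /eqP->;
  try (by move=> _ /(nzN 2 F2)); try (by move=> _ /(nzN 4 n4)); try (by move=> _ /(nzN 6 n6));
  try (by move=> _ /(nzN 8 n8)); try (by move=> /(nzP 2 F2)); try (by move=> /(nzP 4 n4));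
  try (by move=> /(nzP 6 n6)); try (by move=> /(nzP 8 n8)).
Qed.

Lemma char3_double (x : D) : (3 : D) = 0 -> x + x = - x.
Proof.
move=> t3; apply/eqP; rewrite -addr_eq0; apply/eqP.
by rewrite -[RHS](mulr0 x) -t3 !mulrDr mulr1 addrA.
Qed.

(** In characteristic 3 the first quadratic is [(x - 1)^2], whose only root is central, and the
    fourth is the opposite of [(x - 1)^2 + 1]. *)
Lemma char3_exceptional (x y : D) : is_division_ring D -> (3 : D) = 0 ->
  x * y <> y * x -> exceptional x ->
  exists2 e : D, [\/ e = 0, e = 1 | e = -1] & (x + e) ^+ 2 = -1.
Proof.
move=> hD t3 nxy [_ ex].
have xN1 : (x - 1) ^+ 2 = x ^+ 2 + x + 1 by rewrite sqrrB1 mulr2n (char3_double x t3) opprK.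
case: ex => e.
- case: nxy; move: xN1; rewrite e expr2 => /(division_mul_eq0 hD) x1.
  have {}x1 : x - 1 = 0 by case: x1.
  by rewrite (subr0_eq x1) mul1r mulr1.
- by exists 0; [constructor 1 | apply/eqP; rewrite -addr_eq0 addr0 e].
- by exists 1; [constructor 2 | apply/eqP; rewrite -addr_eq0 [x + 1]addrC e].
- exists (-1); [by constructor 3 | rewrite xN1].
  have e2 : x ^+ 2 + x = 1.
    apply: oppr_inj; apply/eqP; rewrite -addr_eq0 -e opprD.
    by rewrite -!(char3_double _ t3) !mulr_natl !mulr2n.
  by rewrite e2 char3_double.
Qed.

(** If both were exceptional, [(x + y + e)^2 = (x - y + d)^2 = -1]. Adding these, with [k = e + d]
    and [x^2 = -1], gives [x k = (y + e)^2 + (y - d)^2]. A nonzero [k] makes [x] commute with [y];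
    if [k = 0], the square of [y + e] vanishes and [y] is central. *)
Lemma char3_sum (x y : D) : is_division_ring D -> (3 : D) = 0 ->
  x * y <> y * x -> x ^+ 2 = -1 -> ~ exceptional (x + y) \/ ~ exceptional (x - y).
Proof.
move=> hD t3 nxy x2; apply: contrapT => h.
have [h1 h2] : exceptional (x + y) /\ exceptional (x - y).
  by split; apply: contrapT => k; apply: h; [left | right].
have [|e he e1] := @char3_exceptional (x + y) y hD t3 _ h1.
  by rewrite mulrDl mulrDr => /addIr.
have [|d hd d1] := @char3_exceptional (x - y) y hD t3 _ h2.
  by rewrite mulrBl mulrBr => /addIr.
have cen (u z : D) : [\/ u = 0, u = 1 | u = -1] -> z * u = u * z.
  by case=> ->; rewrite ?mul0r ?mulr0 ?mul1r ?mulr1 ?mulN1r ?mulrN1.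
pose k := e + d.
have kc z : z * k = k * z by rewrite mulrDr mulrDl !(cen _ _ he) !(cen _ _ hd).
have xk : x * k = (y + e) ^+ 2 + (y - d) ^+ 2.
  have : (x + y + e) ^+ 2 + (x - y + d) ^+ 2 - x ^+ 2 - x ^+ 2 = 0.
    by rewrite e1 d1 x2 opprK subrK addNr.
  have kE : k = (y + e) - (y - d) by rewrite opprB [RHS]addrC addrA subrK addrC.
  have -> : x + y + e = x + (y + e) by rewrite addrA.
  have -> : x - y + d = x - (y - d) by rewrite opprB addrA addrAC.
  have kx := kc x; rewrite kE in kx *.
  have sq u v : (x + u) ^+ 2 + (x - v) ^+ 2 - x ^+ 2 - x ^+ 2
                = (u ^+ 2 + v ^+ 2) + (x * (u - v) + (u - v) * x).
    rewrite !expr2 !(mulrDl, mulrDr, mulNr, mulrN, opprK).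
    rewrite [LHS](AC ((2*2)*(2*2)*1*1) ((1*9)*(5*10)*((4*8)*((2*6)*(3*7)))))%AC /=.
    by rewrite !subrr !add0r.
  rewrite sq.
  by rewrite -kx (char3_double _ t3) => /eqP; rewrite subr_eq0 => /eqP.
have uy : y * (y + e) ^+ 2 = (y + e) ^+ 2 * y.
  by apply/commrX/commrD; [exact: commr_refl | apply: cen].
have vy : y * (y - d) ^+ 2 = (y - d) ^+ 2 * y.
  by apply/commrX/commrB; [exact: commr_refl | apply: cen].
have [k0|k0] := eqVneq k 0; last first.
  apply: nxy; apply: (mulIr (hD _ k0)).
  by rewrite -mulrA kc mulrA -[RHS]mulrA xk mulrDl mulrDr uy vy.
have uv : y + e = y - d by congr (_ + _); apply/eqP; rewrite -addr_eq0 -/k k0.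
move: xk; rewrite k0 mulr0 -uv (char3_double _ t3) => /esym/eqP.
rewrite oppr_eq0 => /eqP; rewrite expr2 => /(division_mul_eq0 hD) ye.
have {}ye : y + e = 0 by case: ye.
apply: nxy; have -> : y = - e by apply/eqP; rewrite -addr_eq0 ye.
by rewrite mulrN mulNr (cen _ _ he).
Qed.

(** An exceptional [y] excludes characteristic 2. If 3 is invertible, a shift of [y] serves; in
    characteristic 3 some shift [u] of [y] squares to -1, and [u + x] or [u - x] serves. *)
Lemma nonexceptional_noncommuting (E : D -> Prop) (x y : D) :
  is_division_ring D -> E 1 -> (forall u v, E u -> E v -> E (u - v)) ->
  E x -> E y -> x * y <> y * x ->
  exists z, [/\ E z, ~ exceptional z & x * z <> z * x].
Proof.
move=> hD E1 EB Ex Ey nxy.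
have E0 : E 0 by rewrite -(subrr 1); apply: EB.
have EN u : E u -> E (- u) by rewrite -[- u]sub0r; apply: EB.
have ED u v : E u -> E v -> E (u + v) by move=> Eu Ev; rewrite -[v]opprK; apply/EB/EN.
have sh e : [\/ e = 0, e = 1 | e = -1] -> E (y + e) /\ x * (y + e) <> (y + e) * x.
  move=> he; split; first by apply: ED => //; case: he => ->; last exact: EN.
  rewrite mulrDl mulrDr => h; apply: nxy; move: h; case: he => ->;
    rewrite ?mul0r ?mulr0 ?mul1r ?mulr1 ?mulN1r ?mulrN1; exact: addIr.
have [ey|ney] := EM (exceptional y); last by exists y.
have t2 : (2 : D) != 0 by case: ey.
have [t3|t3] := eqVneq (3 : D) 0; last first.
  have [|e he ne] := @shift_nonexceptional y x hD t2 t3; first exact/nesym.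
  by exists (y + e); have [? ?] := sh e he.
have [e he e2] := @char3_exceptional y x hD t3 (nesym nxy) ey.
have [Eu nu] := sh e he; set u := y + e in Eu nu e2.
have [ns|ns] := char3_sum hD t3 (nesym nu) e2.
- exists (u + x); split=> //; first exact: ED.
  by rewrite mulrDl mulrDr => /addIr.
- exists (u - x); split=> //; first exact: EB.
  by rewrite mulrBl mulrBr => /addIr.
Qed.

Lemma locally_solvable_commutative (E : D -> Prop) :
  is_division_ring D -> E 1 -> (forall u v, E u -> E v -> E (u - v)) ->
  (forall s : seq D, (forall z, z \in s -> E z /\ z != 0) ->
     solvable_grp (gen (fun z => z \in s))) ->
  abelian_set E.
Proof.
move=> hD E1 EB sol x y Ex Ey; apply: contrapT => nxy.
(* [y] is replaced first, against [x]; then [x] is replaced against the new [y']. *)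
have [y' [Ey' ny' nxy']] := nonexceptional_noncommuting hD E1 EB Ex Ey nxy.
have [x' [Ex' nx' nxy'']] := nonexceptional_noncommuting hD E1 EB Ey' Ex (nesym nxy').
have ED v : E v -> E (1 + v).
  by move=> Ev; rewrite -[v]opprK -[- v]sub0r; apply/EB/EB => //; rewrite -(subrr 1); apply: EB.
have nz (u v : D) : u * v <> v * u -> u != 0.
  by move=> n; apply/eqP => u0; apply: n; rewrite u0 mul0r mulr0.
have nz1 (u v : D) : u * v <> v * u -> 1 + u != 0.
  move=> n; apply: (nz (1 + u) v) => h; apply: n; move: h.
  by rewrite mulrDl mulrDr mul1r mulr1 => /addrI.
apply: (nxy''); apply: solvable_commute => //.
- exact: nz nxy''.
- exact: nz1 nxy''.
- exact: nz (nesym nxy'').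
- exact: nz1 (nesym nxy'').
apply: sol => z; rewrite !inE => /or4P[] /eqP->; split; auto.
- exact: nz nxy''.
- exact: nz1 nxy''.
- exact: nz (nesym nxy'').
- exact: nz1 (nesym nxy'').
Qed.

End Subgroups.

(** * The Cartan-Brauer-Hua theorem and bounds on dimension *)

Section Dimension.
Variable D : unitRingType.
Hypothesis hD : is_division_ring D.

Definition division_subring (E : D -> Prop) : Prop :=
  [/\ E 1, forall u v, E u -> E v -> E (u - v),
      forall u v, E u -> E v -> E (u * v) & forall u, E u -> E u^-1].

Lemma division_subring_comm_all (S : D -> Prop) : division_subring (comm_all S).
Proof.
split.
- by move=> u _; rewrite mul1r mulr1.
- by move=> u v hu hv w Sw; rewrite mulrBl mulrBr hu ?hv.
- by move=> u v hu hv w Sw; rewrite -mulrA hv // mulrA hu // mulrA.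
- by move=> u hu w Sw; apply/esym/commrV/esym/hu.
Qed.

Lemma division_subring_closed (E : D -> Prop) : division_subring E ->
  [/\ E 0, forall u, E u -> E (- u), forall u v, E u -> E v -> E (u + v) &
      forall (I : Type) (r : seq I) (F : I -> D),
        (forall i, E (F i)) -> E (\sum_(i <- r) F i)].
Proof.
case=> E1 EB EM EV; have E0 : E 0 by rewrite -(subrr 1); apply: EB.
have EN u : E u -> E (- u) by move=> Eu; rewrite -sub0r; apply: EB.
have ED u v : E u -> E v -> E (u + v).
  by move=> Eu Ev; rewrite -[v]opprK; apply/EB/EN.
by split=> // I r F EF; apply: big_ind.
Qed.

(** An [x] outside [E] commutes with [E], since Hua's trick would otherwise express it by elements
    of [E]. An [x] in [E] is the difference of [z + x] and [z], both outside. *)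
Lemma cartan_brauer_hua (E : D -> Prop) : division_subring E ->
  (forall g e, g \is a GRing.unit -> E e -> E (g * e * g^-1)) ->
  (forall x, E x) \/ (forall x, E x -> center x).
Proof.
move=> hE nE; have [E1 EB Eml EV] := hE; have [E0 EN ED _] := division_subring_closed hE.
have [hall|/existsNP[z nEz]] := EM (forall x, E x); first by left.
right=> e Ee; have out x : ~ E x -> x * e = e * x.
  move=> nEx; have x0 : x \is a GRing.unit.
    by apply: hD; apply: contra_not_neq nEx => ->.
  have x1 : 1 + x \is a GRing.unit.
    apply: hD; apply: contra_not_neq nEx => x1.
    by rewrite -[x](addKr 1) x1 addr0; apply: EN.
  have [||//|[w w1 xE]] := @hua_trick D x e (x * e * x^-1) ((1 + x) * e * (1 + x)^-1) hD.
  - by rewrite mulrVK.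
  - by rewrite mulrVK.
  case: nEx; rewrite xE; apply: Eml; last by apply: EB => //; apply: nE.
  move: w1; set dd := (_ - _) => w1.
  have ud : dd \is a GRing.unit.
    by apply: hD; apply/eqP => d0; move/eqP: w1; rewrite d0 mul0r eq_sym oner_eq0.
  have -> : w = dd^-1 by rewrite -[w](mulKr ud) w1 mulr1.
  by apply: EV; apply: EB; apply: nE.
move=> x; apply/esym; have [Ex|/out//] := EM (E x).
have /out : ~ E (z + x) by move=> h; apply: nEz; rewrite -[z](addrK x); apply: EB.
by rewrite mulrDl mulrDr (out _ nEz) => /addrI.
Qed.

(** Families are functions on [nat] of which only the values below [m] count, so that an induction
    can truncate them. *)
Definition right_independent (C : D -> Prop) m (d : nat -> D) : Prop :=
  forall y : nat -> D, (forall i, (i < m)%N -> C (y i)) ->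
    \sum_(i < m) d i * y i = 0 -> forall i, (i < m)%N -> y i = 0.

(** Dedekind-Artin argument: normalise the last coefficient to 1. Subtracting the relation at [t]
    times [t'] from the one at [t t'] gives a shorter relation with coefficients [t' z_i - z_i t'].
    So the [z_i] centralise [T], and the case [t = 1] contradicts independence. *)
Lemma right_independent_twisted (T : D -> Prop) m (d y : nat -> D) :
  T 1 -> (forall s t, T s -> T t -> T (s * t)) ->
  right_independent (comm_all T) m d ->
  (forall t, T t -> \sum_(i < m) d i * t * y i = 0) ->
  forall i, (i < m)%N -> y i = 0.
Proof.
move=> T1 TM; elim: m y => [//|m IH] y ind hy.
have {}IH (z : nat -> D) : (forall t, T t -> \sum_(i < m) d i * t * z i = 0) ->
    forall i, (i < m)%N -> z i = 0.
  apply: IH => w Cw ew i im.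
  pose w' j := if (j < m)%N then w j else 0.
  have := ind w' _ _ i (ltnW im); rewrite /w' im; apply.
    move=> j _; case: ifP => [/Cw//|_] u _; by rewrite mul0r mulr0.
  rewrite big_ord_recr /= ltnn mulr0 addr0 -[RHS]ew.
  by apply: eq_bigr => j _; rewrite ltn_ord.
have [ym|ym] := eqVneq (y m) 0.
  move=> i; rewrite ltnS leq_eqVlt => /orP[/eqP->//|]; apply: IH => t Tt.
  by have := hy t Tt; rewrite big_ord_recr /= ym mulr0 addr0.
pose z i := y i * (y m)^-1.
have zm : z m = 1 by rewrite /z mulrV // hD.
have hz t : T t -> \sum_(i < m.+1) d i * t * z i = 0.
  move=> Tt; under eq_bigr => i _ do rewrite mulrA.
  by rewrite -mulr_suml hy // mul0r.
have Cz i : (i < m.+1)%N -> comm_all T (z i).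
  rewrite ltnS leq_eqVlt => /orP[/eqP->|im] t' Tt'; first by rewrite zm mul1r mulr1.
  apply/esym/eqP; rewrite -subr_eq0; apply/eqP.
  apply: (IH (fun i => t' * z i - z i * t')) => // t Tt.
  have e1 := hz _ (TM _ _ Tt Tt').
  have e2 : \sum_(i < m.+1) d i * t * (z i * t') = 0.
    under eq_bigr => j _ do rewrite mulrA.
    by rewrite -mulr_suml hz // mul0r.
  have := congr2 (fun u v => u - v) e1 e2; rewrite subrr -sumrB big_ord_recr /= zm.
  rewrite mulr1 mul1r mulrA subrr addr0 => e3; apply: etrans e3; apply: eq_bigr => j _.
  by rewrite mulrBr !mulrA.
have e0 : \sum_(i < m.+1) d i * z i = 0.
  by rewrite -[RHS](hz 1 T1); apply: eq_bigr => i _; rewrite mulr1.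
have := ind z Cz e0 m (ltnSn m); rewrite zm => /eqP.
by rewrite (negPf (oner_neq0 D)).
Qed.

(** Gaussian elimination with coefficients on the left: the last equation is solved for a pivot
    unknown [p], which is substituted into the others. *)
Lemma homogeneous_system (E : D -> Prop) n q (a : nat -> 'I_q -> D) :
  division_subring E -> (forall k i, E (a k i)) -> (n < q)%N ->
  exists y : 'I_q -> D, [/\ forall i, E (y i), exists i, y i != 0 &
    forall k, (k < n)%N -> \sum_i a k i * y i = 0].
Proof.
move=> hE; have [E1 EB Eml EV] := hE; have [E0 EN ED Esum] := division_subring_closed hE.
elim: n q a => [|n IH] [|q] a Ea //.
  by move=> _; exists (fun _ => 1); split=> //; exists ord0; apply: oner_neq0.
rewrite ltnS => nq; have [a0|/existsNP[p /eqP ap]] := EM (forall i, a n i = 0).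
  have [y [Ey ny hy]] := IH _ a Ea (ltnW nq); exists y; split=> // k.
  rewrite ltnS leq_eqVlt => /orP[/eqP->|/hy//].
  by rewrite big1 // => i _; rewrite a0 mul0r.
pose b k j := a k (lift p j) - a k p * (a n p)^-1 * a n (lift p j).
have [|z [Ez [j0 nz] hz]] := IH _ b _ nq.
  by move=> k i; apply: EB => //; apply: (Eml _ _ (Eml _ _ _ (EV _ _)) _).
pose yp := - ((a n p)^-1 * \sum_j a n (lift p j) * z j).
exists (fun i => if unlift p i is Some j then z j else yp); split.
- move=> i; case: unliftP => [j _|_] //.
  by apply/EN/Eml; [exact: EV | apply: Esum => j; apply: Eml].
- by exists (lift p j0); rewrite liftK.
move=> k; rewrite (bigD1_ord p) //= unlift_none.
under eq_bigr => i _ do rewrite liftK.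
rewrite ltnS leq_eqVlt => /orP[/eqP->|/hz hk].
  by rewrite /yp mulrN mulrA mulrV ?hD // mul1r addNr.
apply: etrans hk; rewrite /b /yp mulrN mulrA mulr_sumr addrC -sumrB.
by apply: eq_bigr => j _; rewrite mulrBl !mulrA.
Qed.

Definition cspan (l : seq D) (t : D) : Prop :=
  exists c : nat -> D, (forall i, center (c i)) /\ t = \sum_(i < size l) c i * l`_i.

(** If [m] exceeded the length of [l], the equations obtained by putting [t] equal to each entry of
    [l] would have a nonzero solution. It would then solve the equation for every [t] in [T],
    against [right_independent_twisted]. *)
Lemma right_independent_bound (T : D -> Prop) (l : seq D) m d :
  T 1 -> (forall s t, T s -> T t -> T (s * t)) ->
  (forall t, T t -> cspan l t) ->
  right_independent (comm_all T) m d -> (m <= size l)%N.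
Proof.
move=> T1 TM Tl ind; rewrite leqNgt; apply/negP => lt.
have hT : division_subring (fun _ : D => True) by [].
have [y [_ [i0 ny] hy]] := @homogeneous_system _ (size l) m (fun j i => d i * l`_j) hT (fun _ _ => I) lt.
pose y' i := oapp y 0 (insub i).
have yE (i : 'I_m) : y' i = y i by rewrite /y' valK.
move: ny; rewrite -yE (right_independent_twisted T1 TM ind (y := y')) ?eqxx // => t /Tl.
move=> [c [cc ->]].
under eq_bigr => i _ do rewrite yE mulr_sumr mulr_suml.
rewrite exchange_big big1 //= => j _.
transitivity (c j * \sum_(i < m) d i * l`_j * y i); last by rewrite hy ?mulr0.
by rewrite mulr_sumr; apply: eq_bigr => i _; rewrite !mulrA (cc j (d i)).
Qed.

(** An independent family of maximal length spans: appending [x] creates a relation in which the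
    coefficient of [x] is invertible. *)
Lemma right_spanning (C : D -> Prop) N :
  division_subring C -> (forall m d, right_independent C m d -> (m <= N)%N) ->
  exists m (d : nat -> D), forall x, exists y : nat -> D,
    (forall i, C (y i)) /\ x = \sum_(i < m) d i * y i.
Proof.
move=> hC bound; have [C1 CB CM CV] := hC; have [C0 CN CD Csum] := division_subring_closed hC.
pose P m := `[< exists d, right_independent C m d >].
have P0 : exists m, P m by exists 0%N; apply/asboolP; exists (fun _ => 0).
have Pb m : P m -> (m <= N)%N by move=> /asboolP[d /bound].
case: (ex_maxnP P0 Pb) => m /asboolP[d ind] mx; exists m, d => x.
pose d' i := if (i < m)%N then d i else x.
have nind : ~ right_independent C m.+1 d'.
  by move=> ind'; have := mx m.+1; rewrite ltnn => h; apply/notF/h/asboolP; exists d'.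
move: nind; rewrite /right_independent => /existsNP[y /not_implyP[Cy]].
move=> /not_implyP[+ /existsNP[i /not_implyP[im yi]]].
rewrite big_ord_recr /= {2}/d' ltnn.
rewrite (eq_bigr (fun i : 'I_m => d i * y i)) => [e|j _]; last by rewrite /d' ltn_ord.
have ym : y m != 0.
  apply/eqP => ym; apply: yi; move: im; rewrite ltnS leq_eqVlt => /orP[/eqP->//|].
  apply: (ind y); first by move=> j jm; apply/Cy/ltnW.
  by move: e; rewrite ym mulr0 addr0.
exists (fun i => if (i < m)%N then - (y i * (y m)^-1) else 0); split.
  by move=> j; case: ifP => // jm; apply/CN/CM; [apply/Cy/ltnW | apply/CV/Cy].
move/eqP: e; rewrite addrC addr_eq0 => /eqP e.
rewrite -[LHS](mulrK (hD ym)) e mulNr mulr_suml -sumrN.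
by apply: eq_bigr => j _; rewrite ltn_ord mulrN mulrA.
Qed.

(** Each [x i * d j] expands over [d] with coefficients in [E]. For more than [m^2] elements [x i],
    some nonzero [y] over [E] kills all [m^2] combinations of these coefficients. As [E] is
    commutative, [x i * t * y i] then sums to 0 for all [t] in [D], against independence over the
    center. *)
Lemma finite_over_maximal_subfield (E : D -> Prop) m (d : nat -> D) :
  division_subring E -> abelian_set E ->
  (forall x, exists y : nat -> D,
    (forall i, E (y i)) /\ x = \sum_(i < m) d i * y i) ->
  finite_dim_over_center D.
Proof.
move=> hE abE span.
have [|q [s hs]] := @right_spanning (comm_all (fun _ => True)) (m * m) (division_subring_comm_all _).
  move=> q x ind; rewrite leqNgt; apply/negP => lt.
  have /choice[e he] : forall ij : nat * nat, exists y : nat -> D,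
      (forall l, E (y l)) /\ x ij.1 * d ij.2 = \sum_(l < m) d l * y l by move=> ij; apply: span.
  (* For [k = j m + l], this is the coefficient of [d l] in [x i * d j]. *)
  pose a k (i : 'I_q) := e (val i, k %/ m)%N (k %% m)%N.
  have [|y [Ey [i0 ny] hy]] := @homogeneous_system E (m * m) q a hE _ lt.
    by move=> k i; apply: (he _).1.
  pose y' i := oapp y 0 (insub i).
  have yE (i : 'I_q) : y' i = y i by rewrite /y' valK.
  move: ny; rewrite -yE (right_independent_twisted _ _ ind (y := y')) ?eqxx // => t _.
  have [z [Ez ->]] := span t.
  under eq_bigr => i _ do rewrite yE mulr_sumr mulr_suml.
  rewrite exchange_big big1 //= => j _.
  have -> : \sum_(i < q) x i * (d j * z j) * y i =
      \sum_(i < q) \sum_(l < m) d l * (e (val i, val j) l * y i * z j).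
    apply: eq_bigr => i _; rewrite mulrA (he (val i, val j)).2 !mulr_suml.
    by apply: eq_bigr => l _; rewrite -!mulrA (abE (z j)).
  rewrite exchange_big big1 //= => l _; rewrite -mulr_sumr -mulr_suml.
  have m0 : (0 < m)%N by apply: leq_ltn_trans (ltn_ord l).
  have := hy (j * m + l)%N; rewrite /a divnMDl // modnMDl divn_small // modn_small // addn0.
  by move=> ->; [rewrite mul0r mulr0 | rewrite -ltn_divLR // divnMDl // divn_small // addn0].
exists (mkseq s q) => x; have [y [Cy ->]] := hs x; exists y; split.
  by move=> i u; apply: Cy.
rewrite size_mkseq; apply: eq_bigr => i _; rewrite nth_mkseq //.
by rewrite (Cy i).
Qed.

End Dimension.

(** * Commuting algebraic elements: finite spans and finitely many roots *)

Section Algebraic.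
Variable D : unitRingType.
Hypothesis hD : is_division_ring D.

Let hC : division_subring (@center D).
Proof.
split.
- by move=> u; rewrite mul1r mulr1.
- by move=> u v hu hv w; rewrite mulrBl mulrBr hu hv.
- by move=> u v hu hv w; rewrite -mulrA hv mulrA hu mulrA.
- by move=> u hu w; apply/esym/commrV/esym/hu.
Qed.

Lemma cspan0 l : cspan l (0 : D).
Proof.
have [C0 _ _ _] := division_subring_closed hC.
by exists (fun _ => 0); split=> //; rewrite big1 // => i _; rewrite mul0r.
Qed.

Lemma cspanD l (u v : D) : cspan l u -> cspan l v -> cspan l (u + v).
Proof.
have [_ _ CD _] := division_subring_closed hC.
move=> [a [ca ->]] [b [cb ->]]; exists (fun i => a i + b i); split.
  by move=> i; apply: CD.
by rewrite -big_split; apply: eq_bigr => i _; rewrite mulrDl.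
Qed.

Lemma cspanZ l (z u : D) : center z -> cspan l u -> cspan l (z * u).
Proof.
have [_ _ CM _] := hC.
move=> cz [a [ca ->]]; exists (fun i => z * a i); split.
  by move=> i; apply: CM.
by rewrite mulr_sumr; apply: eq_bigr => i _; rewrite mulrA.
Qed.

Lemma cspan_sum l (I : Type) (r : seq I) (F : I -> D) :
  (forall i, cspan l (F i)) -> cspan l (\sum_(i <- r) F i).
Proof. by move=> h; apply: big_ind => //; [exact: cspan0 | exact: cspanD]. Qed.

Lemma mem_cspan l (u : D) : u \in l -> cspan l u.
Proof.
have [C1 _ _ _] := hC; have [C0 _ _ _] := division_subring_closed hC.
move=> ul; have lt : (index u l < size l)%N by rewrite index_mem.
exists (fun i => if i == index u l then 1 else 0); split.
  by move=> i; case: ifP.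
rewrite (bigD1 (Ordinal lt)) //= eqxx mul1r nth_index // big1 ?addr0 // => i.
by rewrite -val_eqE /= => /negPf->; rewrite mul0r.
Qed.

Lemma cspan_mull l l' (a t : D) :
  (forall v, v \in l -> cspan l' (a * v)) -> cspan l t -> cspan l' (a * t).
Proof.
move=> h [c [cc ->]]; rewrite mulr_sumr; apply: cspan_sum => i.
by rewrite mulrA -(cc i a) -mulrA; apply: cspanZ => //; apply/h/mem_nth.
Qed.

Lemma algebraic_power (a : D) : algebraic_over_center a ->
  exists d (c : nat -> D), [/\ (0 < d)%N, forall i, center (c i) &
    a ^+ d = \sum_(i < d) c i * a ^+ i].
Proof.
have [C1 _ CM CV] := hC; have [_ CN _ _] := division_subring_closed hC.
case=> p [p0 cp ra]; have lc0 : lead_coef p != 0 by rewrite lead_coef_eq0.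
have ulc := hD lc0.
have sp : (1 < size p)%N.
  rewrite ltnNge; apply/negP => sp; move: ra p0.
  by rewrite (size1_polyC sp) rootC => /eqP->; rewrite eqxx.
exists (size p).-1, (fun i => - ((lead_coef p)^-1 * p`_i)); split.
- by rewrite -ltnS prednK // ltnW.
- by move=> i; apply/CN/CM => //; apply: CV; apply: cp.
move: ra; rewrite rootE (@horner_coef_wide _ (size p).-1.+1) ?leqSpred // big_ord_recr /=.
rewrite addrC addr_eq0 -lead_coefE => /eqP e; apply: (mulrI ulc).
rewrite e mulr_sumr -sumrN; apply: eq_bigr => i _.
by rewrite mulNr mulrN -mulrA mulVKr.
Qed.

(** Each new [a] enlarges the spanning list to the products [a^i v] with [i < d], where [a^d] is a
    central combination of lower powers. *)
Lemma commuting_algebraic_span (s : seq D) :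
  {in s &, forall a b, a * b = b * a} ->
  (forall a, a \in s -> algebraic_over_center a) ->
  exists l : seq D, cspan l 1 /\
    forall a t, a \in s -> cspan l t -> cspan l (a * t).
Proof.
elim: s => [|a s IH] cs alg.
  by exists [:: 1]; split=> //; apply: mem_cspan; rewrite inE.
have [b c bs cs'|b bs|l [l1 hl]] := IH.
- by apply: cs; rewrite in_cons ?bs ?cs' orbT.
- by apply: alg; rewrite in_cons bs orbT.
have [d [c [d0 cc ad]]] := algebraic_power (alg a (mem_head _ _)).
pose L := [seq a ^+ i * v | i <- iota 0 d, v <- l].
have powL i t : (i < d)%N -> cspan l t -> cspan L (a ^+ i * t).
  move=> lt_id; apply: cspan_mull => v vl; apply: mem_cspan.
  by apply/allpairsP; exists (i, v); split; rewrite // mem_iota.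
exists L; split; first by rewrite -[1]mulr1 -{1}(expr0 a); apply: powL.
move=> b t; rewrite in_cons => bs; apply: cspan_mull => _ /allpairsP[[i v] /= [ii vl ->]].
have lt_id : (i < d)%N by move: ii; rewrite mem_iota.
case/orP: bs => [/eqP->|bs].
  rewrite mulrA -exprS; have [lt|] := ltnP i.+1 d; first exact/powL/mem_cspan.
  move=> le; have -> : i.+1 = d by apply/eqP; rewrite eqn_leq lt_id.
  rewrite ad mulr_suml; apply: cspan_sum => j.
  by rewrite -mulrA; apply: cspanZ => //; apply/powL/mem_cspan.
have -> : b * (a ^+ i * v) = a ^+ i * (b * v).
  rewrite !mulrA; congr (_ * _); apply: commrX.
  by apply: cs; rewrite in_cons ?eqxx ?bs ?orbT.
by apply: powL => //; apply: hl => //; apply: mem_cspan.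
Qed.

Lemma root_conj (p : {poly D}) (g a : D) : (forall i, center p`_i) ->
  g \is a GRing.unit -> root p a -> root p (g * a * g^-1).
Proof.
move=> cp ug; rewrite !rootE !horner_coef => /eqP e.
have pw n : (g * a * g^-1) ^+ n = g * a ^+ n * g^-1.
  elim: n => [|n IH]; first by rewrite !expr0 mulr1 mulrV.
  by rewrite !exprS IH !mulrA mulrVK.
apply/eqP; transitivity (g * (\sum_(i < size p) p`_i * a ^+ i) * g^-1).
  rewrite mulr_sumr mulr_suml; apply: eq_bigr => i _.
  by rewrite pw !mulrA (cp i g).
by rewrite e mulr0 mul0r.
Qed.

(** Distinct commuting elements have invertible differences, so the size of [p] bounds the number of
    such roots, and a longest list exhausts [O]. *)
Lemma commuting_roots_finite (p : {poly D}) (O : D -> Prop) :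
  p != 0 -> abelian_set O -> (forall x, O x -> root p x) ->
  exists s : seq D, forall x, O x <-> x \in s.
Proof.
move=> p0 abO rO.
pose P n := `[< exists s : seq D, [/\ size s = n, uniq s & forall x, x \in s -> O x] >].
have Pb n : P n -> (n <= size p)%N.
  move=> /asboolP[s [<- us sO]]; apply: ltnW; apply: max_ring_poly_roots => //.
    by apply/allP => x /sO /rO.
  elim: s us sO => //= x s IH /andP[nx us] sO.
  rewrite IH ?andbT //; last by move=> y ys; apply: sO; rewrite in_cons ys orbT.
  apply/allP => y ys; rewrite /diff_roots (abO x y) ?eqxx /=; last 2 first.
  - by apply: sO; rewrite mem_head.
  - by apply: sO; rewrite in_cons ys orbT.
  by apply: hD; rewrite subr_eq0; apply: contraNneq nx => <-.
have P0 : exists n, P n by exists 0%N; apply/asboolP; exists [::].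
case: (ex_maxnP P0 Pb) => n /asboolP[s [sn us sO]] mx; exists s => x.
split=> [Ox|/sO//]; apply: contrapT => /negP nx.
have := mx n.+1; rewrite ltnn => h; apply/notF/h/asboolP; exists (x :: s).
split=> [|//=|y]; rewrite /= ?sn ?nx //.
by rewrite in_cons => /orP[/eqP->|/sO].
Qed.

End Algebraic.

(** * The conjugates of [alpha] and their centraliser *)

Theorem theorem2p5 (D : unitRingType) (M A : D -> Prop) :
  is_division_ring D ->
  (exists x y : D, x * y != y * x) ->
  maximal_subgroup_units M ->
  (exists x y, [/\ M x, M y & x * y != y * x]) ->
  locally_solvable M ->
  max_abelian_normal A M ->
  (exists alpha, [/\ A alpha, ~ center alpha & algebraic_over_center alpha]) ->
  finite_dim_over_center D.
Proof.
move=> hD _ [hM _ maxM] _ solM [[hA AM nA] abA _] [alpha [Aal nal [p [p0 cp pal]]]].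
have [Mu M1 MM MV] := hM.
pose O x := exists2 g, M g & x = g * alpha * g^-1.
have OA x : O x -> A x.
  by move=> [g Mg ->]; have := nA _ _ (MV _ Mg) Aal; rewrite invrK.
have rO x : O x -> root p x.
  by move=> [g Mg ->]; apply: root_conj => //; apply: Mu.
have abO : abelian_set O by move=> x y /OA Ax /OA Ay; apply: abA.
have Oal : O alpha by exists 1; rewrite // mul1r invr1 mulr1.
have OJ g x : M g -> O x -> O (g^-1 * x * g).
  move=> Mg [h Mh ->]; exists (g^-1 * h); first by apply: MM => //; apply: MV.
  by rewrite invrM ?unitrV ?Mu // invrK !mulrA.
pose E := comm_all O.
have hE : division_subring E by apply: division_subring_comm_all.
have [E1 EB Eml EV] := hE.
have EJ g e : M g -> E e -> E (g * e * g^-1).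
  move=> Mg Ee o Oo; have ug := Mu _ Mg.
  have := congr1 (fun w => g * w * g^-1) (Ee _ (OJ _ _ Mg Oo)).
  by rewrite !mulrA mulrV // mul1r mulrK // => <-; rewrite !mulrA.
(* Both inclusions are imposed so that [N] is closed under inverses. *)
pose N g := [/\ g \is a GRing.unit, forall e, E e -> E (g * e * g^-1) &
                forall e, E e -> E (g^-1 * e * g)].
have hN : is_subgroup N.
  split.
  - by move=> x [].
  - by split; [exact: unitr1 | |] => e; rewrite invr1 mul1r mulr1.
  - move=> x y [ux hx hx'] [uy hy hy']; split; first by rewrite unitrMl.
    + by move=> e /hy /hx; rewrite invrM // !mulrA.
    + by move=> e /hx' /hy'; rewrite invrM // !mulrA.
  - by move=> x [ux hx hx']; split; rewrite ?unitrV ?invrK.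
have MN g : M g -> N g.
  move=> Mg; split; first exact: Mu.
    by move=> e; apply: EJ.
  by move=> e; have := @EJ g^-1 e (MV _ Mg); rewrite invrK.
(* If every unit normalises [E], then [E] is all of [D] or central; both make [alpha] central, the
   latter because [alpha] lies in [E]. *)
have [NM|Nall] := maxM N hN MN; last first.
  have [Eall|Ecen] := cartan_brauer_hua hD hE (fun g e ug Ee => let: And3 _ h _ := Nall g ug in h e Ee).
    by case: nal => y; apply/esym/(Eall y).
  by case: nal; apply: Ecen => o Oo; apply: abO.
have abE : abelian_set E.
  (* Nonzero elements of [E] normalise [E], hence lie in [N] and so in [M]. *)
  apply: locally_solvable_commutative => // s hs; apply: solM => z /hs[Ez z0].
  have EVz := EV _ Ez; apply: NM; split; first exact: hD.
    by move=> e Ee; apply: (Eml _ _ (Eml _ _ Ez Ee)).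
  by move=> e Ee; apply: (Eml _ _ (Eml _ _ EVz Ee)).
have [s hs] := commuting_roots_finite hD p0 abO rO.
have [|a sa|l [l1 hl]] := @commuting_algebraic_span D hD s.
- by move=> a b /hs Oa /hs Ob; apply: abO.
- by exists p; split=> //; apply/rO/hs.
(* [T] consists of the multipliers of the span of [l]. It contains [O], so its centraliser lies in
   [E]; and as 1 is in the span, so is [T]. *)
pose T t := forall v, cspan l v -> cspan l (t * v).
have TO (m : nat) d : right_independent E m d -> (m <= size l)%N.
  move=> ind; apply: (@right_independent_bound D hD T l m d).
  - by move=> v; rewrite mul1r.
  - by move=> x y hx hy v lv; rewrite -mulrA; apply/hx/hy.
  - by move=> t /(_ 1 l1); rewrite mulr1.
  - move=> y Cy; apply: ind => i im o /hs so; apply: Cy => // v.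
    exact: hl.
have [m [d span]] := right_spanning hD hE TO.
exact: (finite_over_maximal_subfield hD hE abE span).
Qed.
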